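(* Assume the standing hypotheses on the continuous problem and on the space discretization listed in the context. Assume also that $\partial u\equiv0$ (i.e. $g\equiv 0$), $\sum_{i=1}^sb_i=1$, $u\in C^3([0,T],X)\cap C^1([0,T],Z)$, $\dot u(t)\in D(A)$ for $t\in[0,T]$, $\dot u\in C([0,T],Z)$, $A\dot u\in C([0,T],X)$, and that there is a constant $C$ (independent of $h$, $k$, $n$) with $$\Big\|kA_{h,0}\sum_{r=1}^{n-1}e^{rkA_{h,0}}\Big\|_h\le C,\qquad 0\le nk\le T.$$ Then the global error of the classical Lawson full discretization satisfies $$e_{h,n}=U_h^n-P_hu(t_n)=O(\eta_h+k).$$
   Context: **Continuous problem.** $\Omega\subset\mathbb R^d$ is a bounded domain, $X=C(\overline\Omega)$ with the maximum norm, $Y$ is a Banach space, $A:D(A)\subset X\to X$ and $\partial:D(A)\to Y$ are linear. $u$ is the solution of $u'(t)=Au(t)+f(t,u(t))$, $0\le t\le T$, $u(0)=u_0\in X$, $\partial u(t)=g(t)\in Y$, with $f:[0,T]\times X\to X$ (in general nonlinear) and $g:[0,T]\to Y$. *Standing hypotheses on the continuous problem:* (i) $\partial:D(A)\to Y$ is onto and $g\in C^1([0,T],Y)$. (ii) $\ker\partial$ is dense in $X$ and $A_0$, the restriction of $A$ to $D(A_0)=\ker\partial$, generates a $C_0$-semigroup $\{e^{tA_0}\}_{t\ge0}$ on $X$ of negative type $\omega$. (iii) For $\Re z>0$ and $v\in Y$ the problem $Ax=zx$, $\partial x=v$ has a unique solution $x=K(z)v$, and $\|K(z)v\|\le C\|v\|$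 with $C$ uniform for $\Re z\ge\omega_0>\omega$. (iv) $f\in C^1([0,T]\times X,X)$. (v) $u\in C^1([0,T],X)$, $u(t)\in D(A)$ for all $t\in[0,T]$, $Au\in C([0,T],X)$. **Space discretization.** For a mesh parameter $h$, $\Omega_h$ is a grid with $N$ nodes; $\|\cdot\|_h$ is the maximum norm on $\mathbb C^N$ (and the induced operator norms); $P_h:X\to\mathbb C^N$ maps a function to its values on the grid; $A_{h,0}$ is an $N\times N$ matrix (discretizing $A_0$) and $C_h:Y\to\mathbb C^N$ is linear, so that $A$ acting on functions with $\partial u=g$ is discretized by $A_{h,0}U_h+C_hg$. The function $f$ also makes sense as a map $[0,T]\times\mathbb C^N\to\mathbb C^N$ and $P_hf(t,u)=f(t,P_hu)$ for $t\in[0,T]$, $u\in X$. *Standing hypotheses on the discretization:* (a) $\|e^{tA_{h,0}}\|_h\le1$ for $t\ge0$; $A_{h,0}$ is invertible and $\|A_{h,0}^{-1}\|_h\le C$ with $C$ independent of $h$. (b) Let $R_h:D(A)\to\mathbb C^N$ be defined by $A_{h,0}R_hu+C_h\partial u=P_hAu$. There is a subspace $Z\subset D(A)$ with norm $\|\cdot\|_Z$ such that for $u\in Z$: $A_0^{-1}u\in Z$ and $e^{tA_0}u,f(t,u)\in Z$ for $t\in[0,T]$; $\|A_{h,0}(P_hu-R_hu)\|_h\le\varepsilon_h\|u\|_Z$ and $\|P_hu-R_hu\|_h\le\eta_h\|u\|_Z$, with $\varepsilon_h,\eta_h$ small with $h$. Moreover $\|A_{h,0}^{-1}C_h\|_h\le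 C''$ with $C''$ independent of $h$. (c) $f\in C^1([0,T]\times\mathbb C^N,\mathbb C^N)$ and its derivative with respect to the variable in $\mathbb C^N$ is uniformly bounded in a neighbourhood of the solution where the numerical approximation stays. **Classical Lawson discretization (first space, then time).** Let $a_{ij}$ ($j<i$), $b_i$, $c_i$ ($1\le i\le s$) be the coefficients of an explicit Runge–Kutta tableau. Let $k>0$ be the time stepsize, $t_n=nk\le T$. Starting from $U_h^0=P_hu(0)$, define for $i=1,\dots,s$ $$K_{h,i}^n=e^{c_ikA_{h,0}}U_h^n+k\sum_{j=1}^{i-1}a_{ij}e^{(c_i-c_j)kA_{h,0}}[C_hg(t_n+c_jk)+f(t_n+c_jk,K^n_{h,j})],$$ $$U_h^{n+1}=e^{kA_{h,0}}U_h^n+k\sum_{i=1}^sb_ie^{(1-c_i)kA_{h,0}}[C_hg(t_n+c_ik)+f(t_n+c_ik,K_{h,i}^n)].$$ All $O(\cdot)$ bounds are in $\|\cdot\|_h$, with constants independent of $k$, (small) $h$ and $n$ with $nk\le T$.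
   Formalization: The tableau is additionally assumed to satisfy 0 ≤ c_i ≤ 1, and c_j ≤ c_i whenever j < i and a_ij ≠ 0, so that stage times stay in [0,T] and no backward exponential e^{(c_i-c_j)kA_{h,0}} occurs; without this the bound can fail. *)

(* Defs.v *)
From HB Require Import structures.
From mathcomp Require Import all_boot all_order all_algebra complex.
From mathcomp Require Import all_classical all_reals all_analysis.

Set Implicit Arguments.
Unset Strict Implicit.
Unset Printing Implicit Defensive.

Import Order.TTheory GRing.Theory Num.Theory.
Import numFieldNormedType.Exports.

Local Open Scope classical_set_scope.
Local Open Scope ring_scope.
Local Open Scope complex_scope.

HB.instance Definition _ (R : rcfType) := NormedModule.copy R[i] R[i]^o.

(* The norm of a normed space over R[i] takes its values in R[i]; nrm is the
   same norm as an element of R. *)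
Definition nrm (R : rcfType) (V : normedModType R[i]) (v : V) : R :=
  complex.Re `|v|.

Section Realify.
Variables (R : rcfType) (V : normedModType R[i]).

Lemma nrmE (v : V) : `|v| = (nrm v)%:C.
Proof.
rewrite /nrm; have := normr_ge0 v; case: `|v| => a b.
by rewrite lecE/= => /andP[/eqP -> _].
Qed.

Lemma nrmD (v w : V) : nrm (v + w) <= nrm v + nrm w.
Proof. by rewrite -lecR rmorphD/= -!nrmE ler_normD. Qed.

Lemma nrmZ (a : R[i]) (v : V) : nrm (a *: v) = complex.Re `|a| * nrm v.
Proof. by rewrite /nrm normrZ nrmE normc_def /= mul0r subr0. Qed.

Lemma nrm0_eq0 (v : V) : nrm v = 0 -> v = 0.
Proof. by move=> v0; apply/normr0_eq0; rewrite nrmE v0. Qed.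

Lemma nrm_ge0 (v : V) : 0 <= nrm v.
Proof. by rewrite -lecR -nrmE normr_ge0. Qed.

Lemma nrmN (v : V) : nrm (- v) = nrm v.
Proof. by rewrite /nrm normrN. Qed.

(* V with its scalars restricted to R. *)
Definition realified : Type := V.

HB.instance Definition _ := GRing.Zmodule.copy realified V.

Definition rscale (a : R) (v : realified) : realified := a%:C *: (v : V).

Lemma rscaleA a b v : rscale a (rscale b v) = rscale (a * b) v.
Proof. by rewrite /rscale scalerA rmorphM. Qed.
Lemma rscale1 : left_id 1 rscale.
Proof. by move=> v; rewrite /rscale scale1r. Qed.
Lemma rscaleDr : right_distributive rscale +%R.
Proof. by move=> a v w; rewrite /rscale scalerDr. Qed.
Lemma rscaleDl v : {morph rscale^~ v : a b / a + b}.
Proof. by move=> a b; rewrite /rscale rmorphD scalerDl. Qed.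

HB.instance Definition _ :=
  GRing.Zmodule_isLmodule.Build R realified rscaleA rscale1 rscaleDr rscaleDl.

Lemma rnrmZ (a : R) (v : realified) : nrm (a *: v : V) = `|a| * nrm (v : V).
Proof. by rewrite [a *: v]/(rscale a v) nrmZ normc_def/= expr0n/= addr0 sqrtr_sqr. Qed.

HB.instance Definition _ :=
  @Lmodule_isNormed.Build R realified (@nrm R V) nrmD rnrmZ nrm0_eq0.

End Realify.

Lemma nrm_continuous (R : realType) (V : normedModType R[i]) :
  continuous (@nrm R V).
Proof.
move=> x; apply/cvgrPdist_lt => e e0.
near=> y.
suff : nrm (x - y) < e.
  apply: le_lt_trans; rewrite ler_norml; apply/andP; split.
    rewrite lerNl opprB lerBlDr -[X in X + _]nrmN opprB.
    by rewrite -[X in nrm X](subrK x) nrmD.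
  by rewrite lerBlDr -[X in nrm X](subrK y) nrmD.
rewrite -ltcR -nrmE; near: y; apply: cvgr_dist_lt => //.
by rewrite ltcR.
Unshelve. all: by end_near. Qed.

Record bounded_domain (R : realType) (d : nat) := BoundedDomain {
  domain_set :> set 'rV[R]_d ;
  domain_neq0 : domain_set !=set0 ;
  domain_open : open domain_set ;
  domain_connected : connected domain_set ;
  domain_bounded : bounded_set domain_set }.

Section ContinuousFunctions.
Variables (R : realType) (d : nat) (Om : bounded_domain R d).

Definition Cbar : Type := continuousType (closure Om) R[i].

Definition Cbar_fun (u : Cbar) : closure Om -> R[i] := u : continuousType _ _.
Coercion Cbar_fun : Cbar >-> Funclass.

HB.instance Definition _ := Choice.copy Cbar (continuousType (closure Om) R[i]).

Implicit Types u v w : Cbar.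

Lemma Cbar_cts u : continuous (u : closure Om -> R[i]).
Proof. exact: cts_fun. Qed.

Lemma CbarP u v : u =1 v -> u = v.
Proof. by move=> uv; apply/continuousEP. Qed.

Definition mkCbar (u : closure Om -> R[i]) (cu : continuous u) : Cbar :=
  (mkcts cu : continuousType _ _).

Lemma Cbar_add_cts u v : continuous (fun x => u x + v x).
Proof. by move=> x; apply: continuousD; exact: Cbar_cts. Qed.
Lemma Cbar_opp_cts u : continuous (fun x => - u x).
Proof. by move=> x; apply: continuousN; exact: Cbar_cts. Qed.
Lemma Cbar_scale_cts (a : R[i]) u : continuous (fun x => a * u x).
Proof. by move=> x; apply: continuousM; [exact: cst_continuous|exact: Cbar_cts]. Qed.
Lemma Cbar_zero_cts : continuous (fun _ : closure Om => 0 : R[i]).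
Proof. by move=> x; exact: cst_continuous. Qed.

Definition Cbar_add u v := mkCbar (@Cbar_add_cts u v).
Definition Cbar_opp u := mkCbar (@Cbar_opp_cts u).
Definition Cbar_scale a u := mkCbar (@Cbar_scale_cts a u).
Definition Cbar_zero := mkCbar (@Cbar_zero_cts).

Lemma Cbar_addA : associative Cbar_add.
Proof. by move=> u v w; apply: CbarP => x; exact: addrA. Qed.
Lemma Cbar_addC : commutative Cbar_add.
Proof. by move=> u v; apply: CbarP => x; exact: addrC. Qed.
Lemma Cbar_add0 : left_id Cbar_zero Cbar_add.
Proof. by move=> u; apply: CbarP => x; exact: add0r. Qed.
Lemma Cbar_addN : left_inverse Cbar_zero Cbar_opp Cbar_add.
Proof. by move=> u; apply: CbarP => x; exact: addNr. Qed.

HB.instance Definition _ :=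
  GRing.isZmodule.Build Cbar Cbar_addA Cbar_addC Cbar_add0 Cbar_addN.

Lemma Cbar_scaleA a b u : Cbar_scale a (Cbar_scale b u) = Cbar_scale (a * b) u.
Proof. by apply: CbarP => x; exact: mulrA. Qed.
Lemma Cbar_scale1 : left_id 1 Cbar_scale.
Proof. by move=> u; apply: CbarP => x; exact: mul1r. Qed.
Lemma Cbar_scaleDr : right_distributive Cbar_scale +%R.
Proof. by move=> a u v; apply: CbarP => x; exact: mulrDr. Qed.
Lemma Cbar_scaleDl u : {morph Cbar_scale^~ u : a b / a + b}.
Proof. by move=> a b; apply: CbarP => x; exact: mulrDl. Qed.

HB.instance Definition _ := GRing.Zmodule_isLmodule.Build R[i] Cbar
  Cbar_scaleA Cbar_scale1 Cbar_scaleDr Cbar_scaleDl.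

(* The maximum norm; the supremum is attained, closure Om being compact. *)
Definition Cbar_sup u : R := sup [set nrm (u x) | x in [set: closure Om]].
Definition Cbar_norm u : R[i] := (Cbar_sup u)%:C.

Lemma closure_domain_compact : compact (closure Om).
Proof.
apply: bounded_closed_compact; last exact: closed_closure.
have [M [Mr HM]] := domain_bounded Om.
exists (M + 1); split; first exact: num_real.
move=> N MN x clx; suff : closure Om `<=` [set y | `|y| <= N] by apply.
rewrite closureE => y; apply; split; last first.
  by move=> z Omz; apply: HM Omz; rewrite (lt_trans _ MN)// ltrDl.
by apply: (@closed_comp _ _ _ [set r : R | r <= N]);
  [move=> z _; exact: norm_continuous|exact: closed_le].
Qed.

Lemma closure_domain_setT_compact : compact [set: closure Om].
Proof.
move=> F FF _.
have [|p [clp Fp]] := @closure_domain_compact (set_val @ F) _.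
  rewrite /nbhs/=; apply: filterS (@filterT _ F _) => x _ /=.
  by rewrite set_valE; case: x => x xcl; exact: set_mem.
exists (SigSub (mem_set clp)); split=> // A B FA [C [[W oW <-] Cp CB]].
have [||x [[y Ay <-] Wy]] := Fp (set_val @` A) W.
- by rewrite /nbhs/=; apply: filterS FA => y Ay; exists y.
- exact: open_nbhs_nbhs.
by exists y; split=> //; exact: CB.
Qed.

Lemma Cbar_has_sup u : has_sup [set nrm (u x) | x in [set: closure Om]].
Proof.
split.
  have [x Omx] := domain_neq0 Om.
  have clx : closure Om x by exact: subset_closure.
  by exists (nrm (u (SigSub (mem_set clx)))), (SigSub (mem_set clx)).
have : compact [set (nrm (u x) : R) | x in [set: closure Om]].
  apply: (@continuous_compact _ _ (fun x => nrm (u x))).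
    apply: continuous_subspaceT => x.
    by apply: continuous_comp; [exact: Cbar_cts|exact: nrm_continuous].
  exact: closure_domain_setT_compact.
move=> /compact_bounded [M [_ /(_ (M + 1))]].
rewrite ltrDl ltr01 => /(_ isT) HM; exists (M + 1) => y /HM.
by apply: le_trans; exact: ler_norm.
Qed.

Lemma nrm_le_Cbar_sup u x : nrm (u x) <= Cbar_sup u.
Proof. by apply: sup_upper_bound; [exact: Cbar_has_sup|exists x]. Qed.

Lemma Cbar_sup_le u (M : R) : (forall x, nrm (u x) <= M) -> Cbar_sup u <= M.
Proof.
move=> uM; apply: ge_sup; first by case: (Cbar_has_sup u).
by move=> _ [x _ <-].
Qed.

Lemma Cbar_normD u v : Cbar_norm (u + v) <= Cbar_norm u + Cbar_norm v.
Proof.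
rewrite -rmorphD lecR; apply: Cbar_sup_le => x.
by apply: le_trans (nrmD _ _) _; apply: lerD; exact: nrm_le_Cbar_sup.
Qed.

Lemma Cbar_norm_eq0 u : Cbar_norm u = 0 -> u = 0.
Proof.
move=> [u0]; apply: CbarP => x; apply: nrm0_eq0; apply/le_anti.
by rewrite nrm_ge0 -u0 nrm_le_Cbar_sup.
Qed.

Lemma Cbar_sup_ge0 u : 0 <= Cbar_sup u.
Proof.
have [[_ [x _ _]] _] := Cbar_has_sup u.
by apply: le_trans (nrm_le_Cbar_sup u x); exact: nrm_ge0.
Qed.

Lemma Cbar_normZ (a : R[i]) u : Cbar_norm (a *: u) = `|a| * Cbar_norm u.
Proof.
rewrite nrmE -rmorphM; congr (_%:C); apply/le_anti/andP; split.
  apply: Cbar_sup_le => x; rewrite nrmZ.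
  by apply: ler_wpM2l; [exact: (@nrm_ge0 R R[i] a)|exact: nrm_le_Cbar_sup].
have [a0|a0] := eqVneq (nrm a) 0; first by rewrite a0 mul0r Cbar_sup_ge0.
have ap : 0 < nrm a by rewrite lt_def a0 nrm_ge0.
rewrite mulrC -ler_pdivlMr//; apply: Cbar_sup_le => x.
by rewrite ler_pdivlMr// mulrC -nrmZ; exact: (nrm_le_Cbar_sup (a *: u)).
Qed.

HB.instance Definition _ :=
  @Lmodule_isNormed.Build R[i] Cbar Cbar_norm
    Cbar_normD Cbar_normZ Cbar_norm_eq0.

End ContinuousFunctions.

(* v is the derivative of u on [0, T], one-sided at the end points. *)
Definition derivative_on (R : realType) (V : normedModType R[i]) (T : R)
    (u v : R -> V) :=
  forall t : R, 0 <= t <= T ->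
    ((s - t)^-1)%:C *: (u s - u t) @[s --> within `[0, T] t^'] --> v t.

Fixpoint Ck (R : realType) (V : normedModType R[i]) (T : R) (m : nat)
    (u : R -> V) : Prop :=
  if m is m'.+1 then exists v, derivative_on T u v /\ Ck T m' v
  else {within `[0, T], continuous u}.

(* At each point of D there is a bounded R-linear Df x with
   f y = f x + Df x (y - x) + o(y - x) as y -> x in D, and Df is continuous
   on D for the operator norm. *)
Definition C1_on (R : realType) (E F : normedModType R) (D : set E)
    (f : E -> F) :=
  exists Df : E -> {linear E -> F}, forall x, D x ->
  [/\ continuous (Df x),
      (forall e : R, 0 < e -> \forall y \near within D (nbhs x),
        `|f y - f x - Df x (y - x)| <= e * `|y - x|) &
      (forall e : R, 0 < e -> \forall y \near within D (nbhs x),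
        forall v, `|Df y v - Df x v| <= e * `|v|)].

(* C^1([0, T] x V, W) with real differentiability, so that nonlinearities such
   as |u|^2 u are allowed. *)
Definition C1_time_space (R : realType) (V W : normedModType R[i]) (T : R)
    (f : R -> V -> W) :=
  @C1_on R (R * realified V)%type (realified W) (`[0, T] `*` setT)
    (fun p => f p.1 p.2).

Definition opnorm_le (R : realType) (V W : normedModType R[i]) (L : V -> W)
    (c : R) := forall v, nrm (L v) <= c * nrm v.

Definition linear_on (K : nzRingType) (V W : lmodType K) (D : set V)
    (L : V -> W) :=
  D 0 /\ forall a x y, D x -> D y ->
    D (a *: x + y) /\ L (a *: x + y) = a *: L x + L y.

Record C0_semigroup (R : realType) (V : normedModType R[i]) (S : R -> V -> V)
    : Prop := {
  C0_linear : forall t : R, 0 <= t -> linear (S t) ;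
  C0_bounded : forall t : R, 0 <= t -> exists M, opnorm_le (S t) M ;
  C0_0 : forall x, S 0 x = x ;
  C0_D : forall (s t : R) x, 0 <= s -> 0 <= t -> S (s + t) x = S s (S t x) ;
  C0_cont : forall x, S t x @[t --> 0^'+] --> x }.

(* A matters on D only; existence of the limit characterizes D. *)
Definition is_generator (R : realType) (V : normedModType R[i])
    (D : set V) (A : V -> V) (S : R -> V -> V) :=
  forall x y, (D x /\ A x = y) <->
    (t^-1)%:C *: (S t x - x) @[t --> 0^'+] --> y.

(* The growth bound of S, which may be -oo. *)
Definition semigroup_type (R : realType) (V : normedModType R[i])
    (S : R -> V -> V) : \bar R :=
  ereal_inf [set w%:E | w in [set w : R |
    exists M, forall t : R, 0 <= t -> opnorm_le (S t) (M * expR (w * t))]].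

Definition expmx (R : realType) (n : nat) (M : 'M[R[i]]_n) : 'M[R[i]]_n :=
  limn (series (fun j => (j`!%:R)^-1 *: M ^+ j)).

Section ContinuousProblem.
Variables (R : realType) (d : nat) (Om : bounded_domain R d).
Variable Y : completeNormedModType R[i].
Let X := Cbar Om.

(* A and bd are total functions, meaningful on DA only. *)
Record continuous_problem (T : R) (DA : set X) (A : X -> X) (bd : X -> Y)
    (f : R -> X -> X) (g : R -> Y) (S : R -> X -> X) (omega : \bar R)
    (u0 : X) (u : R -> X) : Prop := {
  cp_A_linear : linear_on DA A ;
  cp_bd_linear : linear_on DA bd ;
  cp_u0 : u 0 = u0 ;
  cp_ode : derivative_on T u (fun t => A (u t) + f t (u t)) ;
  cp_bc : forall t : R, 0 <= t <= T -> bd (u t) = g t ;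
  cp_onto : forall v, exists2 x, DA x & bd x = v ;
  cp_g : Ck T 1 g ;
  cp_dense : dense [set x | DA x /\ bd x = 0] ;
  cp_semigroup : C0_semigroup S ;
  cp_generator : is_generator [set x | DA x /\ bd x = 0] A S ;
  cp_type : semigroup_type S = omega ;
  cp_type_lt0 : (omega < 0)%E ;
  cp_elliptic : forall (z : R[i]) (v : Y), 0 < complex.Re z ->
    exists! x, [/\ DA x, A x = z *: x & bd x = v] ;
  cp_elliptic_bound : exists (omega0 C : R), (omega < omega0%:E)%E /\
    forall (z : R[i]) (v : Y) (x : X),
      0 < complex.Re z -> omega0 <= complex.Re z ->
      [/\ DA x, A x = z *: x & bd x = v] -> nrm x <= C * nrm v ;
  cp_f : C1_time_space T f ;
  cp_u : Ck T 1 u ;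
  cp_u_dom : forall t : R, 0 <= t <= T -> DA (u t) ;
  cp_Au : {within `[0, T], continuous (fun t => A (u t))} }.

End ContinuousProblem.

Section SpaceDiscretization.
Variables (R : realType) (d : nat) (Om : bounded_domain R d).
Variable Y : completeNormedModType R[i].
Let X := Cbar Om.

Definition grid_values (n : nat) (node : 'I_n -> closure Om) (u : X) :
  'cV[R[i]]_n := \col_i u (node i).

(* Z is modelled as a complex normed space with an injective linear map incl
   into X whose image is the subspace; "x is in Z" reads "x = incl z". *)
Record space_discretization (T : R) (DA : set X) (A : X -> X) (bd : X -> Y)
    (f : R -> X -> X) (S : R -> X -> X)
    (Z : normedModType R[i]) (incl : {linear Z -> X})
    (H : set R) (N : R -> nat) (node : forall h, 'I_(N h) -> closure Om)
    (Ah : forall h, 'M[R[i]]_(N h)) (Ch : forall h, {linear Y -> 'cV[R[i]]_(N h)})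
    (Rh : forall h, X -> 'cV[R[i]]_(N h))
    (fh : forall h, R -> 'cV[R[i]]_(N h) -> 'cV[R[i]]_(N h))
    (eps eta : R -> R) : Prop := {
  sd_mesh : forall h, H h -> 0 < h ;
  sd_grid : forall h, H h -> injective (node h) ;
  sd_fh : forall h, H h -> forall (t : R) x, 0 <= t <= T ->
    grid_values (node h) (f t x) = fh h t (grid_values (node h) x) ;
  sd_contr : forall h, H h -> forall t : R, 0 <= t ->
    opnorm_le (fun V : 'cV_(N h) => expmx (t%:C *: Ah h) *m V) 1 ;
  sd_unit : forall h, H h -> Ah h \in unitmx ;
  sd_inv : exists C, forall h, H h ->
    opnorm_le (fun V : 'cV_(N h) => invmx (Ah h) *m V) C ;
  sd_Rh : forall h, H h -> forall x, DA x ->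
    Ah h *m Rh h x + Ch h (bd x) = grid_values (node h) (A x) ;
  sd_incl_inj : injective incl ;
  sd_incl_dom : forall z, DA (incl z) ;
  sd_A0inv : forall z x, DA x -> bd x = 0 -> A x = incl z ->
    exists z', x = incl z' ;
  sd_S : forall z (t : R), 0 <= t <= T -> exists z', S t (incl z) = incl z' ;
  sd_f : forall z (t : R), 0 <= t <= T -> exists z', f t (incl z) = incl z' ;
  sd_eps : forall h, H h -> forall z : Z,
    nrm (Ah h *m (grid_values (node h) (incl z) - Rh h (incl z)))
      <= eps h * nrm z ;
  sd_eta : forall h, H h -> forall z : Z,
    nrm (grid_values (node h) (incl z) - Rh h (incl z)) <= eta h * nrm z ;
  sd_eps_ge0 : forall h, H h -> 0 <= eps h ;
  sd_eta_ge0 : forall h, H h -> 0 <= eta h ;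
  sd_eps_small : eps @ within H (0^'+) --> 0 ;
  sd_eta_small : eta @ within H (0^'+) --> 0 ;
  sd_invC : exists C, forall h, H h ->
    opnorm_le (fun v => invmx (Ah h) *m Ch h v) C ;
  sd_fh_C1 : forall h, H h -> C1_time_space T (fh h) }.

End SpaceDiscretization.

Section Lawson.
Variables (R : realType) (s : nat) (a : 'I_s -> 'I_s -> R) (b c : 'I_s -> R).
Variables (Y : completeNormedModType R[i]) (n : nat) (A : 'M[R[i]]_n).
Variables (C : {linear Y -> 'cV[R[i]]_n}) (g : R -> Y).
Variables (f : R -> 'cV[R[i]]_n -> 'cV[R[i]]_n) (k : R).

(* The right-hand sides of the stage equations, as a map on families of stages;
   t and U stand for t_n and U_h^n. *)
Definition lawson_stage_map (t : R) (U : 'cV[R[i]]_n)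
    (K : 'I_s -> 'cV[R[i]]_n) (i : 'I_s) : 'cV[R[i]]_n :=
  expmx ((c i * k)%:C *: A) *m U
  + k%:C *: \sum_(j < s | (j < i)%N) (a i j)%:C *:
      (expmx (((c i - c j) * k)%:C *: A)
         *m (C (g (t + c j * k)) + f (t + c j * k) (K j))).

(* Only earlier stages enter, so s iterations from any family solve the stage
   equations; see lawson_stagesE. *)
Definition lawson_stages (t : R) (U : 'cV[R[i]]_n) : 'I_s -> 'cV[R[i]]_n :=
  iter s (lawson_stage_map t U) (fun=> 0).

Lemma lawson_stagesE t U i :
  lawson_stages t U i = lawson_stage_map t U (lawson_stages t U) i.
Proof.
have stable m (j : 'I_s) : (j < m)%N ->
    iter m (lawson_stage_map t U) (fun=> 0) j
    = iter m.+1 (lawson_stage_map t U) (fun=> 0) j.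
  elim: m j => [//|m IH] j; rewrite ltnS => jm.
  rewrite (iterS m.+1) [in LHS]iterS {1 3}/lawson_stage_map; congr (_ + _ *: _).
  by apply: eq_bigr => l lj; rewrite -IH//; exact: leq_trans jm.
by rewrite /lawson_stages stable.
Qed.

Definition lawson_step (t : R) (U : 'cV[R[i]]_n) : 'cV[R[i]]_n :=
  expmx (k%:C *: A) *m U
  + k%:C *: \sum_(i < s) (b i)%:C *:
      (expmx (((1 - c i) * k)%:C *: A)
         *m (C (g (t + c i * k)) + f (t + c i * k) (lawson_stages t U i))).

Fixpoint lawson (U0 : 'cV[R[i]]_n) (m : nat) : 'cV[R[i]]_n :=
  if m is m'.+1 then lawson_step (m'%:R * k) (lawson U0 m') else U0.

End Lawson.

(* Stage times t_n + c_i k lie in [t_n, t_{n+1}], and only matrices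
   e^{sigma k A_{h,0}} with sigma >= 0 enter the stages. *)
Definition admissible_tableau (R : realType) (s : nat) (a : 'I_s -> 'I_s -> R)
    (c : 'I_s -> R) :=
  (forall i, 0 <= c i <= 1) /\
  (forall i j : 'I_s, (j < i)%N -> a i j != 0 -> c j <= c i).

Section NearSolution.
Variables (R : realType) (d : nat) (Om : bounded_domain R d).
Variable Y : completeNormedModType R[i].

(* The tube of radius delta around the solution is the neighbourhood on which
   the derivative of fh h t is bounded; the approximations lawson ... n and
   their stages stay in it. *)
Definition bounded_near_solution (T : R) (H : set R) (N : R -> nat)
    (node : forall h, 'I_(N h) -> closure Om)
    (Ah : forall h, 'M[R[i]]_(N h))
    (Ch : forall h, {linear Y -> 'cV[R[i]]_(N h)}) (g : R -> Y)
    (fh : forall h, R -> 'cV[R[i]]_(N h) -> 'cV[R[i]]_(N h))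
    (u : R -> Cbar Om)
    (s : nat) (a : 'I_s -> 'I_s -> R) (b c : 'I_s -> R) (kmax : R) :=
  let Pu h t := grid_values (node h) (u t) in
  let U h k n := lawson a b c (Ah h) (Ch h) g (fh h) k (Pu h 0) n in
  exists delta L : R, 0 < delta /\ forall h, H h ->
  [/\ (forall (t : R) (V W : 'cV[R[i]]_(N h)), 0 <= t <= T ->
        nrm (V - Pu h t) <= delta ->
        nrm (('d (fh h t : realified _ -> realified _)
               (V : realified _) W) : 'cV[R[i]]_(N h))
          <= L * nrm W),
      (forall (k : R) n, 0 < k <= kmax -> n%:R * k <= T ->
        nrm (U h k n - Pu h (n%:R * k)) <= delta) &
      (forall (k : R) n i, 0 < k <= kmax -> n.+1%:R * k <= T ->
        nrm (lawson_stages a c (Ah h) (Ch h) g (fh h) k (n%:R * k) (U h k n) i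
             - Pu h (n%:R * k + c i * k)) <= delta)].

End NearSolution.

(* Main.v *)
Require Import Defs.
From HB Require Import structures.
From mathcomp Require Import all_boot all_order all_algebra complex.
From mathcomp Require Import all_classical all_reals all_analysis ring lra.

Set Implicit Arguments.
Unset Strict Implicit.
Unset Printing Implicit Defensive.

Import Order.TTheory GRing.Theory Num.Theory.
Import numFieldNormedType.Exports.

Local Open Scope classical_set_scope.
Local Open Scope ring_scope.
Local Open Scope complex_scope.

(* Write E(t) = e^{t A_h}, p = P_h u, r = R_h u and F = P_h f(t, u).  Since the
   boundary data vanish, A_h r = P_h A u, so p' = A_h r + F.  The numerical
   solution is compared with r rather than with p: e_n = U_n - r(t_n) satisfies
       e_{n+1} = E(k) e_n + k A_h w_n + N_n,
   where |w_n| = O(k), |w_{n+1} - w_n| = O(k^2) and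
   |N_n| = O(k (|e_n| + k + eta_h)); the projection error p - r enters N_n only
   through its increments, which are O(k eta_h) because u is C^1 in Z.  The terms
   k A_h w_n are individually only O(k), but summation by parts against the sums
   k A_h \sum_r E(r k), bounded by hypothesis, shows that they accumulate to
   O(k).  A discrete Gronwall inequality controls N_n.  That E is a semigroup
   follows from the Cauchy product of partial sums, whose remainder is dominated
   by the one of the real exponential series. *)

(** * Mean value inequalities on a segment *)

(** The terms [(E(k) - 1 - k A_h) r] and [(E(sigma k) - 1) F] of the local error would be [O(k^2)]
    if [A_h] could be applied twice to [r] and once to [F]; uniformly in [h] only [A_h r] and [F]
    are controlled. Writing [r = A_h (A_h^-1 r)] and [F = A_h (A_h^-1 F)] pulls one [A_h] to the
    front, and this is the origin of [w_n]: what remains asks for [A_h^2] on [A_h^-1 r] and [A_h] on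
    [A_h^-1 F]. As [w_n] is linear in the pair [(r, F)], its increments gain a further factor [k]
    from the Lipschitz continuity in time of [P_h A u] and [F]. The other obstacle is uniformity in
    [h]: for the largest-entry norm the product estimate of matrices carries the number of nodes as
    a factor. Power series are therefore used only to justify limits and infinitesimal increments.
    The quantitative bounds on [E(t)] come from contractivity through a mean value inequality proved
    without integrals; hence remainders such as [L k^2] where an integral would give [L k^2 / 2].
    All data constants are majorized by one [M], and the final constant is an explicit function of
    [T] and [M]. *)

Section Calculus.
Variables (R : realType).

Lemma nrmZr (V : normedModType R[i]) (a : R) (v : V) :
  nrm (a%:C *: v) = `|a| * nrm v.
Proof. by rewrite nrmZ normc_def/= expr0n/= addr0 sqrtr_sqr. Qed.

Lemma nrm0 (V : normedModType R[i]) : nrm (0 : V) = 0.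
Proof. by rewrite /nrm normr0. Qed.

Lemma nrmB (V : normedModType R[i]) (v w : V) : nrm (v - w) = nrm (w - v).
Proof. by rewrite -nrmN opprB. Qed.

Lemma nrm_sum (V : normedModType R[i]) I (r : seq I) (P : pred I) (F : I -> V) :
  nrm (\sum_(i <- r | P i) F i) <= \sum_(i <- r | P i) nrm (F i).
Proof.
elim/big_ind2 : _ => [|v x w y vx wy|//]; first by rewrite nrm0.
by apply: le_trans (nrmD _ _) _; exact: lerD.
Qed.

Lemma nrm_near_limit (V : normedModType R[i]) (I : Type) (F : set_system I)
    {FF : Filter F} (w : I -> V) (l : V) (e : R) :
  w @ F --> l -> 0 < e -> \forall i \near F, nrm (l - w i) <= e.
Proof.
move=> /cvgrPdist_le wl e0; have /wl : 0 < e%:C by rewrite ltcR.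
by apply: filterS => i; rewrite nrmE lecR.
Qed.

(** Continuous induction: the supremum [c] of the points reached from [a] with slope [M] is itself
    reached, and it cannot lie below [b]. Only a slope bound around each fixed centre [x] enters,
    which is what a one-sided or restricted derivative provides. *)
Lemma mean_value_le (V : normedModType R[i]) (phi : R -> V) (a b M : R) :
  a <= b ->
  (forall x, a <= x <= b -> \forall y \near x, a <= y <= b ->
    nrm (phi y - phi x) <= M * `|y - x|) ->
  nrm (phi b - phi a) <= M * (b - a).
Proof.
move=> ab loc.
pose S := [set x | a <= x <= b /\ nrm (phi x - phi a) <= M * (x - a)].
have Sa : S a by split; rewrite ?lexx ?ab// !subrr nrm0 mulr0.
have ubS : ubound S b by move=> x [/andP[]].
have hS : has_sup S by split; [exists a|exists b].
have step x y : S x -> a <= y <= b -> x <= y ->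
    nrm (phi y - phi x) <= M * (y - x) -> S y.
  move=> [_ Sx] aby xy h; split=> //.
  have -> : phi y - phi a = (phi y - phi x) + (phi x - phi a).
    by rewrite addrA subrK.
  apply: le_trans (nrmD _ _) _; apply: le_trans (lerD h Sx) _.
  by rewrite -mulrDr addrA subrK.
set c := sup S.
have cab : a <= c <= b.
  by rewrite sup_upper_bound//= ge_sup//; exists a.
have /nbhs_ballP[e /= e0 he] := loc c cab.
(* The neighbourhood of [c] contains points of [S] to its left, and the slope bound centred at [c]
   links such a point to [c]. *)
have Sc : S c.
  have [x Sx cx] := sup_adherent e0 hS.
  have xc : x <= c by exact: sup_upper_bound.
  have [/andP[ax xb] _] := Sx.
  apply: (step _ _ Sx cab xc); rewrite nrmB -[X in M * X]opprB -(ler0_norm (x := x - c)) ?subr_le0//.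
  apply: he; last by rewrite ax.
  by rewrite /ball/= ger0_norm ?subr_ge0// ltrBlDl -ltrBlDr.
have [cb|bc] := ltP c b; last first.
  by have -> : b = c; [apply/le_anti; rewrite bc; case/andP: cab => _ ->|case: Sc].
(* If [c < b], the same neighbourhood yields a point of [S] beyond the supremum. *)
pose y := Num.min b (c + e / 2).
have cy : c < y by rewrite lt_min cb ltrDl divr_gt0.
have yb : a <= y <= b by rewrite ge_min lexx/= andbT (le_trans _ (ltW cy))//; case/andP: cab.
have : S y.
  apply: (step _ _ Sc yb (ltW cy)); rewrite -(ger0_norm (x := y - c)) ?subr_ge0 ?(ltW cy)//.
  apply: he => //.
  rewrite /ball/= distrC ger0_norm ?subr_ge0 1?ltW// ltrBlDl.
  by rewrite (le_lt_trans (y := c + e / 2)) ?ge_min ?lexx ?orbT// ltrD2l ltr_pdivrMr// ltr_pMr// ltr1n.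
by move=> /(sup_upper_bound hS); rewrite -/c leNgt cy.
Qed.

Lemma lipschitz_of_near (V : normedModType R[i]) (T : R) (phi : R -> V) (M : R) :
  (forall x, 0 <= x <= T -> \forall y \near x, 0 <= y <= T ->
    nrm (phi y - phi x) <= M * `|y - x|) ->
  forall x y, 0 <= x <= T -> 0 <= y <= T ->
    nrm (phi y - phi x) <= M * `|y - x|.
Proof.
move=> loc x y; wlog xy : x y / x <= y.
  move=> W xT yT; have [xy|/ltW yx] := leP x y; first exact: W.
  by rewrite nrmB distrC; exact: W.
move=> /andP[x0 xT] /andP[y0 yT]; rewrite ger0_norm ?subr_ge0//.
apply: mean_value_le => // z /andP[xz zy].
have zT : 0 <= z <= T by rewrite (le_trans x0)// (le_trans zy).
apply: filterS (loc z zT) => w h /andP[xw wy]; apply: h.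
by rewrite (le_trans x0)// (le_trans wy).
Qed.

(** Clearing the denominator makes [x = t] admissible, so the neighbourhood is no longer punctured
    and fits [mean_value_le]. *)
Lemma derivative_on_near (V : normedModType R[i]) (T : R) (u v : R -> V)
    (t e : R) :
  derivative_on T u v -> 0 <= t <= T -> 0 < e ->
  \forall x \near t, 0 <= x <= T ->
    nrm (u x - u t - (x - t)%:C *: v t) <= e * `|x - t|.
Proof.
move=> du tT e0.
have FF : Filter (within `[0, T] t^') by exact: within_filter.
have := @nrm_near_limit _ _ _ FF _ _ _ (du t tT) e0.
rewrite near_withinE near_withinE => H. apply: filterS H => x h xT.
have [->|xt] := eqVneq x t; first by rewrite !subrr scale0r subrr nrm0 normr0 mulr0.
have xt0 : x - t != 0 by rewrite subr_eq0.
rewrite nrmB.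
have -> : (x - t)%:C *: v t - (u x - u t) =
    (x - t)%:C *: (v t - (x - t)^-1%:C *: (u x - u t)).
  by rewrite scalerBr scalerA -rmorphM/= divff// scale1r.
rewrite nrmZr mulrC ler_wpM2r//; apply: h => //=.
Qed.

(** Compactness in near-covering form, with the bound itself running along [+oo]. The predicate [P]
    is kept abstract because it serves both for norms of curves and for operator norms of
    derivatives. *)
Lemma locally_bounded_segment (T : R) (P : R -> R -> Prop) :
  (forall M M' x, M <= M' -> P M x -> P M' x) ->
  (forall x, 0 <= x <= T -> exists M, \forall y \near x, 0 <= y <= T -> P M y) ->
  exists M, 0 <= M /\ forall x, 0 <= x <= T -> P M x.
Proof.
move=> mono loc.
have /compact_near_coveringP/near_covering_withinP cov := @segment_compact R 0 T.
have : \forall M \near +oo%R, `[0, T] `<=` P M.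
  apply: cov => x /=; rewrite in_itv/= => xT; have [M HM] := loc x xT.
  near=> y M'.
  have Py : 0 <= y <= T -> P M y by near: y.
  rewrite /= in_itv/= => /Py; apply: mono.
  by near: M'; exact: nbhs_pinfty_ge (num_real _).
move=> h; have h0 := nbhs_pinfty_ge (num_real (0 : R)).
have [M [M0 HM]] := filter_ex (filterI h0 h).
by exists M; split=> // x xT; apply: HM; rewrite /= in_itv.
Unshelve. all: by end_near. Qed.

Lemma continuous_segment_bounded (V : normedModType R[i]) (T : R) (u : R -> V) :
  {within `[0, T], continuous u} ->
  exists M, 0 <= M /\ forall x, 0 <= x <= T -> nrm (u x) <= M.
Proof.
move=> cu; apply: (@locally_bounded_segment T (fun M x => nrm (u x) <= M)).
  by move=> M M' x MM'; move/le_trans; exact.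
move=> x xT; exists (nrm (u x) + 1).
have cux : u @ within `[0, T] (nbhs x) --> u x.
  by move/subspace_continuousP : cu; apply; rewrite /= in_itv.
have FF : Filter (within `[0, T] (nbhs x)) by exact: within_filter.
have := @nrm_near_limit _ _ _ FF _ _ _ cux ltr01.
rewrite near_withinE; apply: filterS => y h yT.
have {h} := h _; rewrite /= in_itv/= => /(_ yT) h.
rewrite -[u y](subrK (u x)) addrC; apply: le_trans (nrmD _ _) _.
by rewrite lerD2l nrmB.
Qed.

Lemma lipschitz_bounded (V : normedModType R[i]) (T L : R) (u : R -> V) :
  0 <= T ->
  0 <= L -> (forall x y, 0 <= x <= T -> 0 <= y <= T ->
    nrm (u y - u x) <= L * `|y - x|) ->
  exists M, 0 <= M /\ forall x, 0 <= x <= T -> nrm (u x) <= M.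
Proof.
move=> T0 L0 Lu; exists (nrm (u 0) + L * T); split.
  by rewrite addr_ge0 ?nrm_ge0 ?mulr_ge0.
move=> x /andP[x0 xT]; rewrite -[u x](subrK (u 0)) addrC.
apply: le_trans (nrmD _ _) _; rewrite lerD2l.
apply: le_trans (Lu _ _ _ _) _; rewrite ?lexx ?x0 ?T0//.
by rewrite subr0 ger0_norm// ler_wpM2l.
Qed.

(** The extra 1 in the slope absorbs the remainder of the derivative near each point. *)
Lemma derivative_bounded_lipschitz (V : normedModType R[i]) (T M : R)
    (u v : R -> V) :
  derivative_on T u v -> (forall x, 0 <= x <= T -> nrm (v x) <= M) ->
  forall x y, 0 <= x <= T -> 0 <= y <= T ->
    nrm (u y - u x) <= (M + 1) * `|y - x|.
Proof.
move=> du vM; apply: lipschitz_of_near => x xT.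
apply: filterS (derivative_on_near du xT ltr01) => y h yT.
rewrite -[u y - u x](subrK ((y - x)%:C *: v x)).
apply: le_trans (nrmD _ _) _; rewrite addrC mulrDl; apply: lerD; last exact: h.
by rewrite nrmZr mulrC ler_wpM2r// vM.
Qed.

Lemma C1_lipschitz (V : normedModType R[i]) (T : R) (u : R -> V) :
  Ck T 1 u -> exists L, 0 <= L /\
  forall x y, 0 <= x <= T -> 0 <= y <= T -> nrm (u y - u x) <= L * `|y - x|.
Proof.
move=> [v [du /continuous_segment_bounded[M [M0 vM]]]].
exists (M + 1); split; first by rewrite addr_ge0.
exact: derivative_bounded_lipschitz vM.
Qed.

(** The function [u] minus its tangent at [t] has derivative [v x - v t], of norm at most [L k] on a
    step of length [k]. *)
Lemma taylor1_le (V : normedModType R[i]) (T L : R) (u v : R -> V) :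
  derivative_on T u v ->
  (forall x y, 0 <= x <= T -> 0 <= y <= T -> nrm (v y - v x) <= L * `|y - x|) ->
  0 <= L ->
  forall t k, 0 <= t -> 0 <= k -> t + k <= T ->
    nrm (u (t + k) - u t - k%:C *: v t) <= L * k ^+ 2.
Proof.
move=> du Lv L0 t k t0; rewrite le_eqVlt => /predU1P[<-|k0] tkT.
  by rewrite addr0 subrr scale0r subrr nrm0 expr0n mulr0.
apply/ler_addgt0Pr => e e0.
pose phi x := u x - (x - t)%:C *: v t.
have -> : u (t + k) - u t - k%:C *: v t = phi (t + k) - phi t.
  by rewrite /phi subrr scale0r subr0 addrAC [t + k]addrC addrK addrAC.
(* The slope [e / k] is reserved for the remainder of the derivative; over the step it costs [e],
   which is arbitrary. *)
have -> : L * k ^+ 2 + e = (L * k + e / k) * (t + k - t).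
  by rewrite [t + k]addrC addrK mulrDl divfK ?gt_eqF// expr2 mulrA.
apply: mean_value_le; first by rewrite lerDl ltW.
move=> x /andP[tx xk].
have xT : 0 <= x <= T by rewrite (le_trans t0)// (le_trans xk).
apply: filterS (derivative_on_near du xT (divr_gt0 e0 k0)) => y h /andP[ty yk].
have {}h := h _; have yT : 0 <= y <= T by rewrite (le_trans t0)// (le_trans yk).
have -> : phi y - phi x =
    (y - x)%:C *: (v x - v t) + (u y - u x - (y - x)%:C *: v x).
  have yxt : (y - t)%:C = (y - x)%:C + (x - t)%:C :> R[i].
    by rewrite -rmorphD/= addrA subrK.
  rewrite /phi yxt scalerBr scalerDl.
  set p := _ *: v x; set q := _ *: v t; set r := _ *: v t.
  by rewrite [RHS]addrC [RHS]addrA subrK opprB opprD !addrA subrK addrAC.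
apply: le_trans (nrmD _ _) _; rewrite mulrDl; apply: lerD; last exact: h.
rewrite nrmZr mulrC ler_wpM2r//; apply: le_trans (Lv _ _ _ _) _ => //.
  by rewrite t0/= (le_trans _ tkT)// lerDl ltW.
by rewrite ler_wpM2l// ger0_norm ?subr_ge0// lerBlDl.
Qed.

(** [Ck] gives a derivative only existentially; uniqueness identifies it with the right-hand side of
    the evolution equation, end points included. *)
Lemma derivative_on_unique (V : normedModType R[i]) (T : R) (u v w : R -> V) :
  0 < T -> derivative_on T u v -> derivative_on T u w ->
  forall t, 0 <= t <= T -> v t = w t.
Proof.
move=> T0 dv dw t tT; apply/eqP; rewrite -subr_eq0; apply/eqP/nrm0_eq0/le_anti.
rewrite nrm_ge0 andbT; apply/ler_addgt0Pr => e e0; rewrite add0r.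
have e20 : 0 < e / 2 by rewrite divr_gt0.
have near_both : \forall x \near t, (0 <= x <= T ->
      nrm (u x - u t - (x - t)%:C *: v t) <= e / 2 * `|x - t|) /\
    (0 <= x <= T -> nrm (u x - u t - (x - t)%:C *: w t) <= e / 2 * `|x - t|).
  by apply: filterI; exact: derivative_on_near.
have /nbhs_ballP[r /= r0 hr] := near_both.
(* A comparison point other than [t] is taken on the side of [t] where at least [T / 2] of the
   segment remains. *)
have [x [xT xt xr]] : exists x, [/\ 0 <= x <= T, x != t & ball t r x].
  have [tT2|T2t] := leP t (T / 2).
  - exists (t + Num.min (T / 2) (r / 2)).
    have m0 : 0 < Num.min (T / 2) (r / 2) by rewrite lt_min !divr_gt0.
    split; first (case/andP: tT => t0 _; rewrite addr_ge0 ?(ltW m0)//=).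
    + by rewrite [leRHS]splitr lerD// ge_min lexx.
    + by rewrite addrC -subr_eq0 addrK gt_eqF.
    + rewrite /ball/= opprD addrA subrr sub0r normrN (ger0_norm (ltW m0)).
      by rewrite gt_min [X in _ || X]ltr_pdivrMr// ltr_pMr// ltr1n orbT.
  - exists (t - Num.min (T / 2) (r / 2)).
    have m0 : 0 < Num.min (T / 2) (r / 2) by rewrite lt_min !divr_gt0.
    split; first (case/andP: tT => _ t0; apply/andP; split).
    + by rewrite subr_ge0 (le_trans _ (ltW T2t))// ge_min lexx.
    + by rewrite (le_trans _ t0)// gerBl ltW.
    + by rewrite -subr_eq0 addrAC subrr sub0r oppr_eq0 gt_eqF.
    + rewrite /ball/= opprB addrA [t + _]addrC addrK (ger0_norm (ltW m0)).
      by rewrite gt_min [X in _ || X]ltr_pdivrMr// ltr_pMr// ltr1n orbT.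
have [/(_ xT) h1 /(_ xT) h2] := hr _ xr.
have xt0 : 0 < `|x - t| by rewrite normr_gt0 subr_eq0.
rewrite -(ler_pM2l xt0) -nrmZr mulrC.
have -> : (x - t)%:C *: (v t - w t) =
   (u x - u t - (x - t)%:C *: w t) - (u x - u t - (x - t)%:C *: v t).
  by rewrite scalerBr opprB [RHS]addrC addrA subrK.
apply: le_trans (nrmD _ _) _; rewrite nrmN (le_trans (lerD h2 h1))//.
by rewrite -mulrDl -splitr.
Qed.

End Calculus.

(** * Nonlinearities: Lipschitz bounds along curves and on balls *)

Section FrechetDerivatives.
Variables (R : realType).

(** The curve is only Lipschitz, so there is no derivative to chain with. Operator-norm continuity
    bounds [Df] near each point of the curve, compactness of [[0, T]] makes this one bound [B], and
    the local slopes [(B + 1) * (L + 1)] are then glued together. *)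
Lemma C1_curve_lipschitz (V W : normedModType R[i]) (T L : R) (f : R -> V -> W)
    (u : R -> V) :
  0 <= L -> C1_time_space T f ->
  (forall x y, 0 <= x <= T -> 0 <= y <= T -> nrm (u y - u x) <= L * `|y - x|) ->
  exists M, 0 <= M /\ forall x y, 0 <= x <= T -> 0 <= y <= T ->
    nrm (f y (u y) - f x (u x)) <= M * `|y - x|.
Proof.
move=> L0 [Df hDf] uL.
pose E := (R * realified V)%type.
pose cur (t : R) : E := (t, u t : realified V).
have Dcur t : 0 <= t <= T -> (`[0, T] `*` [set: realified V]) (cur t).
  by move=> tT; split=> //=; rewrite in_itv.
have cur_lip x y : 0 <= x <= T -> 0 <= y <= T ->
    `|cur y - cur x| <= (L + 1) * `|y - x|.
  move=> xT yT; rewrite prod_normE/= ge_max; apply/andP; split.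
    by rewrite mulrDl mul1r lerDr mulr_ge0.
  have -> : `|(u y : realified V) - u x| = nrm (u y - u x) by [].
  by apply: le_trans (uL _ _ xT yT) _; rewrite ler_wpM2r// lerDl.
have cur_near t (P : set E) : 0 <= t <= T ->
    (\forall y \near within (`[0, T] `*` setT) (nbhs (cur t)), P y) ->
    \forall s \near t, 0 <= s <= T -> P (cur s).
  move=> tT; rewrite near_withinE => /nbhs_normP[r /= r0 hr].
  have L1 : 0 < L + 1 by rewrite ltr_wpDl.
  apply/nbhs_normP; exists (r / (L + 1)) => /=; first exact: divr_gt0.
  move=> s /=; rewrite ltr_pdivlMr// mulrC => ts sT.
  apply: hr; last exact: Dcur.
  by rewrite /= (le_lt_trans (cur_lip _ _ _ _))// distrC.
have [B [B0 DfB]] : exists B, 0 <= B /\ forall t, 0 <= t <= T ->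
    forall v, `|Df (cur t) v| <= B * `|v|.
  apply: (@locally_bounded_segment R T
    (fun B t => forall v, `|Df (cur t) v| <= B * `|v|)).
    by move=> M M' x MM' h v; apply: le_trans (h v) _; rewrite ler_wpM2r.
  move=> t tT; have [cD _ nD] := hDf _ (Dcur t tT).
  have [M0 [_ HM]] : exists M0, M0 \is Num.real /\ forall M, M0 < M ->
      forall v, `|Df (cur t) v| <= M * `|v|.
    have /linear_boundedP := (linear_bounded_continuous (Df (cur t))).2 cD.
    by move=> [M0 [M0r h]]; exists M0; split=> // M /h.
  exists (M0 + 1 + 1); apply: filterS (cur_near _ _ tT (nD 1 ltr01)) => s h sT v.
  rewrite -[Df (cur s) v](subrK (Df (cur t) v)).
  apply: le_trans (ler_normD _ _) _; rewrite addrC mulrDl; apply: lerD.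
    by apply: HM; rewrite ltrDl.
  exact: h.
exists ((B + 1) * (L + 1)); split; first by rewrite mulr_ge0// addr_ge0.
apply: lipschitz_of_near => t tT.
have [_ /(_ 1 ltr01) dD _] := hDf _ (Dcur t tT).
apply: filterS (cur_near _ _ tT dD) => s h sT.
have {}h := h sT.
have -> : nrm (f s (u s) - f t (u t)) =
  `|(f s (u s) : realified W) - f t (u t)| by [].
rewrite -[X in `|X|](subrK (Df (cur t) (cur s - cur t))).
apply: le_trans (ler_normD _ _) _.
apply: le_trans (lerD h (DfB t tT _)) _.
by rewrite addrC -mulrDl -mulrA ler_wpM2l ?addr_ge0// cur_lip.
Qed.

Lemma C1_time_space_diff_near (V W : normedModType R[i]) (T t e : R)
    (f : R -> V -> W) (x : V) :
  C1_time_space T f -> 0 <= t <= T -> 0 < e ->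
  \forall y \near (x : realified V),
    nrm (f t y - f t x
      - ('d (f t : realified V -> realified W) (x : realified V) (y - x) : W))
    <= e * nrm (y - x : V).
Proof.
move=> [Df hDf] tT e0.
pose E := (R * realified V)%type.
pose p : E := (t, x : realified V).
pose emb (v : realified V) : E := (0, v).
have emb_norm v : `|emb v| = `|v| by rewrite prod_normE/= normr0 max_r.
have pB y : ((t, y : realified V) : E) - p = emb (y - x :> realified V).
  by rewrite /emb -[0](subrr t).
have Dp : (`[0, T] `*` [set: realified V]) p by split=> //=; rewrite in_itv.
have [cD dD _] := hDf p Dp.
have lin : linear (fun v => Df p (emb v)).
  move=> a v w; rewrite -linearP; congr (Df p _).
  by congr pair; rewrite /= scaler0 addr0.
pose g : {linear realified V -> realified W} :=
  HB.pack (fun v => Df p (emb v)) (GRing.isLinear.Build _ _ _ _ _ lin).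
have dfe (r : R) : 0 < r -> \forall y \near (x : realified V),
    `|(f t y : realified W) - f t x - g (y - x)|
      <= r * `|(y : realified V) - x|.
  move=> r0; have := dD r r0; rewrite near_withinE => /nbhs_normP[q /= q0 hq].
  apply/nbhs_normP; exists q => //= y xy.
  have := hq (t, y); rewrite pB emb_norm; apply; last by split=> //=; rewrite in_itv.
  by rewrite /= -normrN opprB pB emb_norm -normrN opprB.
suff -> : 'd (f t : realified V -> realified W) (x : realified V) = g
  :> (realified V -> realified W) by exact: dfe.
apply: diff_unique.
  apply/linear_bounded_continuous/linear_boundedP.
  have /linear_boundedP := (linear_bounded_continuous (Df p)).2 cD.
  by apply: filterS => r h v; rewrite -emb_norm; exact: h.
apply/eqaddoP => r r0.
have near0 : nbhs (0 : realified V) (fun v : realified V =>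
    `|(f t (v + x) : realified W) - f t x - g v| <= r * `|v|).
  have /nbhs_normP[q /= q0 hq] := dfe r r0.
  apply/(@nbhs_norm0P R (realified V)); exists q => //= v vq.
  by have := hq (v + x); rewrite /= addrK; apply; rewrite distrC addrK.
by apply: filterS near0 => v; rewrite -addrA -opprD.
Qed.

(** Balls are convex, so the derivative bound holds along the whole segment from [x] to [y] and the
    mean value inequality applies to [f t] on it; the extra 1 is again the slack for the
    remainder. *)
Lemma ball_lipschitz (V W : normedModType R[i]) (T t L delta : R)
    (f : R -> V -> W) (p x y : V) :
  C1_time_space T f -> 0 <= t <= T ->
  (forall v w, nrm (v - p) <= delta ->
     nrm ('d (f t : realified V -> realified W) (v : realified V) w : W)
       <= L * nrm (w : V)) ->
  nrm (x - p) <= delta -> nrm (y - p) <= delta ->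
  nrm (f t y - f t x) <= (L + 1) * nrm (y - x).
Proof.
move=> fC1 tT dL xd yd.
have [yx0|yx0] := eqVneq (nrm (y - x)) 0.
  by rewrite yx0 (subr0_eq (nrm0_eq0 yx0)) subrr nrm0 mulr0.
have yxp : 0 < nrm (y - x) by rewrite lt_def yx0 nrm_ge0.
pose seg (r : R) := x + r%:C *: (y - x).
have segB r q : seg q - seg r = (q - r)%:C *: (y - x).
  by rewrite /seg opprD addrACA subrr add0r -scalerBl rmorphB.
have seg_ball r : 0 <= r <= 1 -> nrm (seg r - p) <= delta.
  move=> /andP[r0 r1]; have -> : seg r - p =
      (1 - r)%:C *: (x - p) + r%:C *: (y - p).
    rewrite /seg rmorphB/= scalerBl scale1r addrAC -[RHS]addrA; congr (_ + _).
    by rewrite [RHS]addrC -scalerBr opprB addrA subrK.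
  apply: le_trans (nrmD _ _) _; rewrite !nrmZr !ger0_norm ?subr_ge0//.
  apply: (@le_trans _ _ ((1 - r) * delta + r * delta)); last by rewrite -mulrDl subrK mul1r.
  by rewrite lerD// ler_wpM2l// subr_ge0.
have := @mean_value_le R W (fun r => f t (seg r)) 0 1 ((L + 1) * nrm (y - x)) ler01.
rewrite /seg scale0r addr0 scale1r addrCA subrr addr0 subr0 mulr1; apply.
move=> r r01.
have /nbhs_normP[q /= q0 hq] := C1_time_space_diff_near (seg r) fC1 tT ltr01.
apply/nbhs_normP; exists (q / nrm (y - x)) => /=; first exact: divr_gt0.
move=> z /=; rewrite ltr_pdivlMr// => rz _.
have szr : nrm (seg z - seg r) = `|z - r| * nrm (y - x) by rewrite segB nrmZr.
have := hq (seg z); rewrite /= => /(_ _).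
have -> : `|(seg r : realified V) - seg z| = nrm (seg r - seg z) by [].
rewrite nrmB szr distrC => /(_ rz) h.
rewrite -/(seg z) -/(seg r).
have -> : f t (seg z) - f t (seg r) =
   (f t (seg z) - f t (seg r) - ('d (f t : realified V -> realified W) (seg r : realified V) (seg z - seg r) : W)) +
     ('d (f t : realified V -> realified W) (seg r : realified V) (seg z - seg r) : W) by rewrite subrK.
apply: le_trans (nrmD _ _) _.
apply: le_trans (lerD h (dL _ _ (seg_ball _ r01))) _.
rewrite szr distrC -mulrDl [1 + L]addrC -mulrA [nrm _ * _]mulrC.
exact: lexx.
Qed.

End FrechetDerivatives.

(** * The matrix exponential *)

Section MatrixNorm.
Variables (R : realType).

Lemma nrm_entry_le (m n : nat) (M : 'M[R[i]]_(m, n)) i j :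
  nrm (M i j) <= nrm M.
Proof.
rewrite -lecR -!nrmE [leRHS]/Num.norm/= mx_normE.
apply: (le_trans _ (_ : (`|M i j|%:nng)%:num <= _)) => //.
rewrite num_le.
exact: (le_bigmax _ (fun ij : 'I_m * 'I_n => `|M ij.1 ij.2|%:nng) (i, j)).
Qed.

Lemma nrm_mx_le (m n : nat) (M : 'M[R[i]]_(m, n)) (c : R) :
  0 <= c -> (forall i j, nrm (M i j) <= c) -> nrm M <= c.
Proof.
move=> c0 Mc; have [M0|M0] := eqVneq (mx_norm M) 0.
  by rewrite (mx_norm_eq0 M0) nrm0.
have [[i j] /= Mij] := mx_norm_neq0 M0.
by rewrite -lecR -nrmE [leLHS]/Num.norm/= Mij nrmE lecR.
Qed.

(** The factor [n] becomes the number of nodes and must not reach the error constants. The estimate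
    is therefore used only where an arbitrarily small quantity, or a step size that later
    disappears, can absorb [n]. *)
Lemma nrm_mulmx_le (m n p : nat) (M : 'M[R[i]]_(m, n)) (W : 'M[R[i]]_(n, p)) :
  nrm (M *m W) <= n%:R * nrm M * nrm W.
Proof.
apply: nrm_mx_le => [|i j]; first by rewrite !mulr_ge0// nrm_ge0.
rewrite mxE; apply: le_trans (nrm_sum _ _ _) _.
rewrite -[n in n%:R]card_ord -mulrA mulr_natl -sumr_const; apply: ler_sum => k _.
have -> : nrm (M i k * W k j) = nrm (M i k) * nrm (W k j).
  by rewrite -[M i k * W k j]/(M i k *: (W k j : R[i]^o)) nrmZ.
by apply: ler_pM; rewrite ?nrm_ge0// nrm_entry_le.
Qed.

Lemma complex_series_cvg (a : R[i]^nat) (b : R^nat) :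
  (forall j, nrm (a j) <= b j) -> cvgn (series b) -> cvgn (series a).
Proof.
move=> ab cb.
have b0 j : 0 <= b j by exact: le_trans (nrm_ge0 _) (ab j).
have cmp (w : R^nat) : (forall j, `|w j| <= nrm (a j)) -> cvgn (series w).
  move=> wa; apply: normed_cvg; apply: series_le_cvg cb => [j|//|j] /=; first by [].
  exact: le_trans (wa j) (ab j).
have cr : cvgn (series (fun j => complex.Re (a j))).
  apply: cmp => j; rewrite /nrm normc_def/= -sqrtr_sqr ler_wsqrtr//.
  by rewrite lerDl sqr_ge0.
have ci : cvgn (series (fun j => complex.Im (a j))).
  apply: cmp => j; rewrite /nrm normc_def/= -sqrtr_sqr ler_wsqrtr//.
  by rewrite lerDr sqr_ge0.
apply/cvg_ex; exists ((limn (series (fun j => complex.Re (a j))))%:C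
  + 'i * (limn (series (fun j => complex.Im (a j))))%:C).
have -> : series a = (fun N => (series (fun j => complex.Re (a j)) N)%:C
   + 'i * (series (fun j => complex.Im (a j)) N)%:C).
  apply/funext => N; rewrite /series/= !rmorph_sum/= mulr_sumr -big_split/=.
  by apply: eq_bigr => j _; rewrite -complexE.
have cvC (w : R^nat) (l : R) : w @ \oo --> l -> (fun N => (w N)%:C : R[i]) @ \oo --> l%:C.
  move=> wl; apply/cvgrPdist_le => e e0.
  have er : e = (nrm e)%:C by rewrite -nrmE gtr0_norm.
  move: e0; rewrite er ltcR => e0.
  move/cvgrPdist_le : wl => /(_ _ e0); apply: filterS => N.
  by rewrite -rmorphB/= normc_def/= expr0n/= addr0 sqrtr_sqr lecR.
by apply: cvgD; [exact: cvC|apply: cvgM; [exact: cvg_cst|exact: cvC]].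
Qed.

Lemma cvg_mx_entries (m n : nat) (w : nat -> 'M[R[i]]_(m, n)) :
  (forall i j, cvgn (fun N => w N i j)) -> cvgn w.
Proof.
move=> cw; apply/cvg_ex.
exists (\matrix_(i, j) limn (fun N => w N i j)) => A [P Pn PA].
have : \forall N \near \oo, forall ij : 'I_m * 'I_n, P ij.1 ij.2 (w N ij.1 ij.2).
  apply: filter_forall => -[i j] /=; have := Pn i j; rewrite mxE.
  exact: cw.
by apply: filterS => N PN; apply: PA => i j; exact: (PN (i, j)).
Qed.

End MatrixNorm.

Section MatrixExponential.
Variables (R : realType) (n : nat).
Implicit Types (M : 'M[R[i]]_n) (v : 'cV[R[i]]_n).

Lemma nrm_expr_mulmx_le M (mu : R) v j :
  (forall w : 'cV_n, nrm (M *m w) <= mu * nrm w) ->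
  nrm (M ^+ j *m v) <= mu ^+ j * nrm v.
Proof.
move=> Mmu; have [v0|v0] := leP (nrm v) 0.
  have -> : v = 0 by apply/nrm0_eq0/le_anti; rewrite v0 nrm_ge0.
  by rewrite mulmx0 nrm0 mulr0.
have mu0 : 0 <= mu.
  by rewrite -(pmulr_lge0 _ v0) (le_trans (nrm_ge0 _) (Mmu v)).
elim: j => [|j IH]; first by rewrite expr0 mul1mx mul1r.
rewrite exprS -mulmxE -mulmxA; apply: le_trans (Mmu _) _.
by rewrite exprS -mulrA ler_wpM2l.
Qed.

Lemma nrm_expr_le M j : nrm (M ^+ j) <= (n%:R * nrm M) ^+ j.
Proof.
apply: nrm_mx_le => [|p q]; first by rewrite exprn_ge0// mulr_ge0// nrm_ge0.
have -> : (M ^+ j) p q = (M ^+ j *m delta_mx q (0 : 'I_1)) p 0.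
  by rewrite -colE mxE.
apply: le_trans (nrm_entry_le _ _ _) _.
apply: le_trans (nrm_expr_mulmx_le _ _ (nrm_mulmx_le M (p := 1))) _.
rewrite ler_piMr ?exprn_ge0 ?mulr_ge0 ?nrm_ge0//.
apply: nrm_mx_le => // i k; rewrite mxE.
by case: (_ && _); rewrite /nrm ?normr1 ?normr0.
Qed.

Definition exp_terms M (j : nat) : 'M[R[i]]_n := (j`!%:R)^-1 *: M ^+ j.

Lemma exp_terms_cvg M : cvgn (series (exp_terms M)).
Proof.
apply: cvg_mx_entries => p q.
pose mu := n%:R * nrm M.
have -> : (fun N => series (exp_terms M) N p q) =
    series (fun j => exp_terms M j p q).
  by apply/funext => N; rewrite /series/= summxE.
apply: (@complex_series_cvg _ _ (exp_coeff mu)); last exact: is_cvg_series_exp_coeff.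
move=> j; rewrite exp_coeffE/= mxE.
have -> : (j`!%:R : R[i])^-1 = (j`!%:R^-1 : R)%:C by rewrite fmorphV rmorph_nat.
rewrite -[_ * _]/(_ *: (_ : R[i]^o)) nrmZr ger0_norm ?invr_ge0//.
rewrite ler_wpM2l ?invr_ge0//.
by apply: le_trans (nrm_entry_le _ _ _) (nrm_expr_le _ _).
Qed.

Lemma expmx_approx M (e : R) : 0 < e ->
  \forall N \near \oo, nrm (expmx M - series (exp_terms M) N) <= e.
Proof. by move=> e0; apply: nrm_near_limit e0; exact: exp_terms_cvg. Qed.

(** Passage to the limit in an estimate of partial sums; [b] varies with [N] so that it can be a
    partial sum of a scalar exponential series. *)
Lemma expmx_mul_le M v (w : 'cV[R[i]]_n) (b : R^nat) (l : R) :
  b @ \oo --> l ->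
  (\forall N \near \oo, nrm (series (exp_terms M) N *m v - w) <= b N) ->
  nrm (expmx M *m v - w) <= l.
Proof.
move=> bl nb; apply/ler_addgt0Pr => e e0.
pose c := n%:R * nrm v + 1.
have c0 : 0 < c by rewrite ltr_wpDl// mulr_ge0// nrm_ge0.
have e20 : 0 < e / 2 by rewrite divr_gt0.
near \oo => N.
have -> : expmx M *m v - w = (expmx M - series (exp_terms M) N) *m v +
    (series (exp_terms M) N *m v - w) by rewrite mulmxBl addrA subrK.
apply: le_trans (nrmD _ _) _.
have -> : l + e = e / 2 + (l + e / 2) by rewrite addrCA -splitr.
apply: lerD; last first.
  apply: (@le_trans _ _ (b N)); first by near: N.
  by near: N; apply: cvgr_le bl _ _; rewrite ltrDl.
apply: le_trans (nrm_mulmx_le _ _) _.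
rewrite mulrAC; apply: (@le_trans _ _ (c * (e / 2 / c))); last first.
  by rewrite mulrC divfK// gt_eqF.
apply: ler_pM; rewrite ?mulr_ge0 ?nrm_ge0//; first by rewrite lerDl.
by near: N; apply: expmx_approx; exact: divr_gt0.
Unshelve. all: by end_near. Qed.

Lemma expmx_comm M B : M *m B = B *m M -> B *m expmx M = expmx M *m B.
Proof.
move=> MB; have MjB j : B *m M ^+ j = M ^+ j *m B.
  elim: j => [|j IH]; first by rewrite !expr0 mulmx1 mul1mx.
  by rewrite exprS -mulmxE mulmxA -MB -mulmxA IH mulmxA.
apply/eqP; rewrite -subr_eq0; apply/eqP/nrm0_eq0/le_anti; rewrite nrm_ge0 andbT.
apply/ler_addgt0Pr => e e0; rewrite add0r.
pose c := n%:R * nrm B + 1.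
have c0 : 0 < c by rewrite ltr_wpDl// mulr_ge0// nrm_ge0.
near \oo => N.
have sc : B *m series (exp_terms M) N = series (exp_terms M) N *m B.
  rewrite /series/= mulmx_sumr mulmx_suml; apply: eq_bigr => j _.
  by rewrite /exp_terms -scalemxAr -scalemxAl MjB.
have -> : B *m expmx M - expmx M *m B = B *m (expmx M - series (exp_terms M) N)
    - (expmx M - series (exp_terms M) N) *m B.
  by rewrite mulmxBr mulmxBl sc opprB addrA subrK.
have h : nrm (expmx M - series (exp_terms M) N) <= e / 2 / c.
  by near: N; apply: expmx_approx; rewrite !divr_gt0.
apply: le_trans (nrmD _ _) _; rewrite nrmN.
apply: le_trans (lerD (nrm_mulmx_le _ _) (nrm_mulmx_le _ _)) _.
rewrite [X in _ + X]mulrAC.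
have hc : n%:R * nrm B * nrm (expmx M - series (exp_terms M) N) <= e / 2.
  apply: (@le_trans _ _ (c * (e / 2 / c))); last by rewrite mulrC divfK// gt_eqF.
  by apply: ler_pM; rewrite ?mulr_ge0 ?nrm_ge0// lerDl.
by rewrite [leRHS]splitr lerD.
Unshelve. all: by end_near. Qed.

End MatrixExponential.

(** * Cauchy products and the semigroup law of the matrix exponential *)

Section ExpProduct.
Variable R : realType.

(** The square of indices splits into the antidiagonals [i + j < N], which form the Cauchy product,
    and the corner [i + j >= N]. *)
Lemma sum_square_split (V : zmodType) (F : nat -> nat -> V) N :
  \sum_(0 <= i < N) \sum_(0 <= j < N) F i j =
  \sum_(0 <= l < N) \sum_(0 <= i < l.+1) F i (l - i)%N +
  \sum_(0 <= i < N) \sum_(N - i <= j < N) F i j.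
Proof.
have -> : \sum_(0 <= l < N) \sum_(0 <= i < l.+1) F i (l - i)%N =
    \sum_(0 <= i < N) \sum_(0 <= j < N - i) F i j.
  elim: N => [|N IH]; first by rewrite !big_geq.
  rewrite big_nat_recr//= IH [RHS]big_nat_recr//= subSnn big_nat1.
  rewrite [X in _ + X]big_nat_recr//= subnn addrA -big_split/=; congr (_ + _).
  apply: eq_big_nat => i /andP[_ iN]; rewrite subSn 1?ltnW//.
  by rewrite big_nat_recr.
rewrite -big_split/=; apply: eq_big_nat => i _.
by rewrite -big_cat_nat//= leq_subr.
Qed.

Lemma exp_coeff_binomial (s t : R) l :
  \sum_(0 <= i < l.+1) (exp_coeff s i * exp_coeff t (l - i)%N) = exp_coeff (s + t) l.
Proof.
rewrite !exp_coeffE/= addrC exprDn mulr_sumr big_mkord; apply: eq_bigr => i _.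
have il : (i <= l)%N by rewrite -ltnS.
rewrite -mulr_natl -(bin_fact il) !natrM.
have c0 : ('C(l, i)%:R : R) != 0 by rewrite pnatr_eq0 -lt0n bin_gt0.
have f0 j : (j`!%:R : R) != 0 by rewrite pnatr_eq0 -lt0n fact_gt0.
by field; rewrite c0 !f0.
Qed.

End ExpProduct.

Section MatrixExponentialSemigroup.
Variables (R : realType) (n : nat).
Implicit Types (A : 'M[R[i]]_n) (v : 'cV[R[i]]_n).

Lemma exp_termsZ A (s : R) j :
  exp_terms (s%:C *: A) j = (exp_coeff s j)%:C *: A ^+ j.
Proof.
rewrite /exp_terms; have -> : (s%:C *: A) ^+ j = (s%:C ^+ j) *: A ^+ j.
  elim: j => [|j IH]; first by rewrite !expr0 scale1r.
  by rewrite !exprS IH -!mulmxE -scalemxAl -scalemxAr scalerA.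
by rewrite exp_coeffE/= scalerA rmorphM/= fmorphV rmorph_nat rmorphXn.
Qed.

Lemma exp_coeffM (s mu : R) j : exp_coeff (s * mu) j = exp_coeff s j * mu ^+ j.
Proof. by rewrite !exp_coeffE/= exprMn mulrA. Qed.

(** On both sides the antidiagonals cancel by the binomial formula and only the corner is left. For
    [s, t >= 0] all scalar coefficients are nonnegative, so the matrix corner is dominated term by
    term by the scalar one. *)
Lemma exp_product_remainder A (s t mu : R) N : 0 <= s -> 0 <= t ->
  mu = n%:R * nrm A ->
  nrm (series (exp_terms (s%:C *: A)) N *m series (exp_terms (t%:C *: A)) N
       - series (exp_terms ((s + t)%:C *: A)) N)
  <= series (exp_coeff (s * mu)) N * series (exp_coeff (t * mu)) N
     - series (exp_coeff ((s + t) * mu)) N.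
Proof.
move=> s0 t0 muE; have mu0 : 0 <= mu by rewrite muE mulr_ge0// nrm_ge0.
rewrite /series/=.
pose F i j := (exp_coeff s i * exp_coeff t j)%:C *: A ^+ (i + j).
pose G i j := exp_coeff (s * mu) i * exp_coeff (t * mu) j.
have -> : (\sum_(0 <= k < N) exp_terms (s%:C *: A) k) *m
    (\sum_(0 <= k < N) exp_terms (t%:C *: A) k) =
    \sum_(0 <= i < N) \sum_(0 <= j < N) F i j.
  rewrite mulmx_suml; apply: eq_bigr => i _; rewrite mulmx_sumr.
  apply: eq_bigr => j _; rewrite !exp_termsZ -scalemxAl -scalemxAr scalerA.
  by rewrite mulmxE -exprD -rmorphM.
have -> : (\sum_(0 <= k < N) exp_coeff (s * mu) k) *
    (\sum_(0 <= k < N) exp_coeff (t * mu) k) =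
    \sum_(0 <= i < N) \sum_(0 <= j < N) G i j.
  by rewrite mulr_suml; apply: eq_bigr => i _; rewrite mulr_sumr.
rewrite !sum_square_split.
have -> : \sum_(0 <= l < N) \sum_(0 <= i < l.+1) F i (l - i)%N =
    \sum_(0 <= k < N) exp_terms ((s + t)%:C *: A) k.
  apply: eq_bigr => l _; rewrite exp_termsZ -exp_coeff_binomial rmorph_sum scaler_suml.
  apply: eq_big_nat => i /andP[_ il]; rewrite /F subnKC//.
have -> : \sum_(0 <= l < N) \sum_(0 <= i < l.+1) G i (l - i)%N =
    \sum_(0 <= k < N) exp_coeff ((s + t) * mu) k.
  by apply: eq_bigr => l _; rewrite mulrDl -exp_coeff_binomial.
rewrite [X in nrm X]addrAC subrr add0r [leRHS]addrAC subrr add0r.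
apply: le_trans (nrm_sum _ _ _) _; apply: ler_sum => i _.
apply: le_trans (nrm_sum _ _ _) _; apply: ler_sum => j _.
have cd0 : 0 <= exp_coeff s i * exp_coeff t j.
  by apply: mulr_ge0; exact: exp_coeff_ge0.
rewrite /F /G nrmZr (ger0_norm cd0) !exp_coeffM [leRHS]mulrACA -exprD.
by rewrite (ler_wpM2l cd0)// muE nrm_expr_le.
Qed.

Lemma nrm_mulmx_perturb (E1 E2 P Q : 'M[R[i]]_n) (e : R) :
  let c := n%:R * (nrm E1 + nrm E2 + 1) + 1 in
  0 < e -> nrm (E1 - P) <= e / c -> nrm (E1 - P) <= 1 -> nrm (E2 - Q) <= e / c ->
  nrm (E1 *m E2 - P *m Q) <= e + e.
Proof.
move=> c e0 h1 hP h2.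
have c0 : 0 < c by rewrite ltr_wpDl// !(mulr_ge0, addr_ge0, nrm_ge0).
have -> : E1 *m E2 - P *m Q = (E1 - P) *m E2 + P *m (E2 - Q).
  by rewrite mulmxBl mulmxBr !addrA subrK.
have scale (x : R) : x <= nrm E1 + nrm E2 + 1 -> n%:R * x * (e / c) <= e.
  move=> xc; have c1 : c != 0 by rewrite gt_eqF.
  have nxc : n%:R * x <= c by rewrite (le_trans (ler_wpM2l _ xc))// lerDl.
  by rewrite -[leRHS](divfK c1) mulrC ler_wpM2l ?divr_ge0 ?(ltW e0) ?(ltW c0).
have E10 := nrm_ge0 E1; have E20 := nrm_ge0 E2.
have PN : nrm P <= nrm E1 + 1.
  rewrite -[P](subrK E1) addrC; apply: le_trans (nrmD _ _) _.
  by rewrite lerD2l nrmB.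
apply: le_trans (nrmD _ _) _; apply: lerD; apply: le_trans (nrm_mulmx_le _ _) _.
- rewrite mulrAC; apply: (le_trans _ (scale (nrm E2) _)); last lra.
  by rewrite ler_wpM2l// mulr_ge0.
- apply: (le_trans _ (scale (nrm P) _)); last lra.
  by rewrite ler_wpM2l// mulr_ge0// nrm_ge0.
Qed.

Lemma expmxD A (s t : R) : 0 <= s -> 0 <= t ->
  expmx ((s + t)%:C *: A) = expmx (s%:C *: A) *m expmx (t%:C *: A).
Proof.
move=> s0 t0; apply/eqP; rewrite eq_sym -subr_eq0; apply/eqP/nrm0_eq0/le_anti.
rewrite nrm_ge0 andbT; apply/ler_addgt0Pr => e e0; rewrite add0r.
set Es := expmx (s%:C *: A); set Et := expmx (t%:C *: A).
set Est := expmx ((s + t)%:C *: A).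
pose P := series (exp_terms (s%:C *: A)); pose Q := series (exp_terms (t%:C *: A)).
pose S := series (exp_terms ((s + t)%:C *: A)).
pose mu := n%:R * nrm A.
pose d N := series (exp_coeff (s * mu)) N * series (exp_coeff (t * mu)) N
     - series (exp_coeff ((s + t) * mu)) N.
have d0 : d @ \oo --> (0 : R).
  have -> : 0 = expR (s * mu) * expR (t * mu) - expR ((s + t) * mu).
    by rewrite -expRD -mulrDl subrr.
  by apply: cvgB; [apply: cvgM|]; exact: is_cvg_series_exp_coeff.
(* The budget: two quarters for replacing both factors by partial sums, one for the Cauchy
   remainder, one for the tail of the exponential at [s + t]. *)
have e40 : 0 < e / 4 by rewrite divr_gt0.
pose c := n%:R * (nrm Es + nrm Et + 1) + 1.
have c0 : 0 < c by rewrite ltr_wpDl// !(mulr_ge0, addr_ge0, nrm_ge0).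
have e4 : 0 < e / 4 / c by rewrite divr_gt0.
have nd : \forall N \near \oo, d N <= e / 4 by apply: cvgr_le d0 _ _.
have [N [[hs ht] [[hst hs1] hd]]] : exists N,
    [/\ nrm (Es - P N) <= e / 4 / c & nrm (Et - Q N) <= e / 4 / c] /\
    [/\ nrm (Est - S N) <= e / 4 & nrm (Es - P N) <= 1] /\ d N <= e / 4.
  have n1 : \forall N \near \oo, nrm (Es - P N) <= e / 4 / c by exact: expmx_approx.
  have n2 : \forall N \near \oo, nrm (Et - Q N) <= e / 4 / c by exact: expmx_approx.
  have n3 : \forall N \near \oo, nrm (Est - S N) <= e / 4 by exact: expmx_approx.
  have n4 : \forall N \near \oo, nrm (Es - P N) <= 1 by exact: expmx_approx.
  have [N h] := filter_ex (filterI (filterI n1 n2) (filterI (filterI n3 n4) nd)).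
  by exists N; case: h => -[? ?] [[? ?] ?].
have h3 : nrm (P N *m Q N - S N) <= e / 4.
  by apply: le_trans hd; exact: exp_product_remainder.
have h12 := nrm_mulmx_perturb e40 hs hs1 ht.
clear hs hs1 ht hd; move: h12 h3 hst.
move: (Es *m Et) (P N *m Q N) (S N) Est => X X' Y Y' XX' XY YY'.
have -> : X - Y' = (X - X') + (X' - Y) - (Y' - Y) by rewrite opprB !addrA !subrK.
apply: le_trans (nrmD _ _) _; rewrite nrmN.
apply: le_trans (lerD (nrmD _ _) (lexx _)) _.
lra.
Qed.

Lemma expmx_first_order A v (mu s : R) : 0 <= s ->
  (forall w : 'cV_n, nrm (A *m w) <= mu * nrm w) ->
  nrm (expmx (s%:C *: A) *m v - (v + s%:C *: (A *m v)))
    <= (expR (s * mu) - (1 + s * mu)) * nrm v.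
Proof.
move=> s0 Amu.
apply: (@expmx_mul_le _ _ _ _ _
  (fun N => (series (exp_coeff (s * mu)) N - (1 + s * mu)) * nrm v)).
  apply: cvgM; last exact: cvg_cst.
  by apply: cvgB; [exact: is_cvg_series_exp_coeff|exact: cvg_cst].
near=> N.
have N2 : (2 <= N)%N by near: N; exact: nbhs_infty_ge.
rewrite /series/= (@big_cat_nat _ _ _ 2)//= [X in _ <= (X - _) * _](@big_cat_nat _ _ _ 2)//=.
have -> : \sum_(0 <= i < 2) exp_coeff (s * mu) i = 1 + s * mu.
  by rewrite big_nat_recr//= big_nat1 !exp_coeffE/= expr0 expr1 fact0 invr1 !mul1r.
have -> : \sum_(0 <= i < 2) exp_terms (s%:C *: A) i = 1%:M + s%:C *: A.
  rewrite big_nat_recr//= big_nat1 !exp_termsZ !exp_coeffE/= expr0 expr1 expr0.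
  by rewrite fact0 invr1 !mul1r scale1r.
rewrite mulmxDl mulmxDl mul1mx -scalemxAl.
rewrite [X in nrm X]addrAC subrr add0r [X in _ <= X * nrm v]addrAC subrr add0r.
rewrite mulmx_suml mulr_suml; apply: le_trans (nrm_sum _ _ _) _.
apply: ler_sum => i _; rewrite exp_termsZ -scalemxAl nrmZr.
have ci0 : 0 <= exp_coeff s i by exact: exp_coeff_ge0.
have -> : exp_coeff (s * mu) i * nrm v = exp_coeff s i * (mu ^+ i * nrm v).
  by rewrite exp_coeffM mulrA.
by rewrite (ger0_norm ci0) (ler_wpM2l ci0)// nrm_expr_mulmx_le.
Unshelve. all: by end_near. Qed.

(** From [1 - x <= exp(-x)] one gets [exp x <= 1 / (1 - x)], and
    [1 / (1 - x) - (1 + x) = x^2 / (1 - x)] is at most [2 x^2] for [x <= 1 / 2]. *)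
Lemma expR_first_order (x : R) : 0 <= x -> x <= 1 / 2 ->
  expR x - (1 + x) <= 2 * x ^+ 2.
Proof.
move=> x0 x1; have e0 : 0 < expR x := expR_gt0 x.
have := expR_ge1Dx (- x); rewrite expRN => h.
have {}h : (1 - x) * expR x <= 1.
  by rewrite -ler_pdivlMr ?div1r.
nra.
Qed.

Lemma expmx_step A v (e : R) : 0 < e -> exists2 r, 0 < r &
  forall s, 0 <= s -> s <= r ->
    nrm (expmx (s%:C *: A) *m v - (v + s%:C *: (A *m v))) <= e * s.
Proof.
move=> e0; pose mu := n%:R * nrm A.
have mu0 : 0 <= mu by rewrite mulr_ge0// nrm_ge0.
have v0 : 0 <= nrm v := nrm_ge0 v.
(* The first entry ensures [s * mu <= 1 / 2], the second that the quadratic remainder is at most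
   [e * s]; adding 1 keeps the denominators positive. *)
pose r := Num.min (1 / (2 * (mu + 1))) (e / (2 * mu ^+ 2 * nrm v + 1)).
have c0 : 0 < 2 * mu ^+ 2 * nrm v + 1 by rewrite ltr_wpDl// mulr_ge0// mulr_ge0// sqr_ge0.
have m0 : 0 < 2 * (mu + 1) by rewrite mulr_gt0// ltr_wpDl.
exists r; first by rewrite lt_min !divr_gt0.
move=> s s0; rewrite le_min => /andP[]; rewrite !ler_pdivlMr// => s1 s2.
apply: le_trans (expmx_first_order v s0 (nrm_mulmx_le A (p := 1))) _.
rewrite -/mu; apply: (@le_trans _ _ (2 * (s * mu) ^+ 2 * nrm v)).
  apply: ler_wpM2r => //; apply: expR_first_order; first by rewrite mulr_ge0.
  nra.
have -> : 2 * (s * mu) ^+ 2 * nrm v = (s * (2 * mu ^+ 2 * nrm v)) * s by ring.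
apply: ler_wpM2r => //; nra.
Qed.

End MatrixExponentialSemigroup.

(** * Contraction semigroups: bounds that do not depend on the dimension *)

Lemma small_step_le (R : realType) (V : normedModType R[i]) (phi : R -> V)
    (t M r : R) : 0 <= t -> 0 < r ->
  (forall x y, 0 <= x -> x <= y -> y <= t -> y - x <= r ->
    nrm (phi y - phi x) <= M * (y - x)) ->
  nrm (phi t - phi 0) <= M * t.
Proof.
move=> t0 r0 step; rewrite -[in leRHS](subr0 t); apply: mean_value_le => // x /andP[x0 xt].
apply/nbhs_normP; exists r => //= y /ltW xyr /andP[y0 yt].
have [xy|/ltW yx] := leP x y.
  rewrite (ger0_norm (x := y - x)) ?subr_ge0//; apply: step => //.
  by rewrite -(ger0_norm (x := y - x)) ?subr_ge0// distrC.
rewrite nrmB distrC (ger0_norm (x := x - y)) ?subr_ge0//; apply: step => //.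
by rewrite -(ger0_norm (x := x - y)) ?subr_ge0.
Qed.

Lemma split_taylor_increment (K : comNzRingType) (n : nat) (X Y : 'M[K]_n)
    (v w : 'cV[K]_n) (a : K) :
  X *m (Y *m v - v) - a *: w =
  X *m (Y *m v - (v + a *: w)) + a *: (X *m w - w).
Proof.
rewrite !mulmxBr mulmxDr -scalemxAr scalerBr.
by rewrite opprD !addrA subrK.
Qed.

Section ContractionSemigroup.
Variables (R : realType) (n : nat) (A : 'M[R[i]]_n).
Let E (t : R) := expmx (t%:C *: A).
Hypothesis contr : forall t : R, 0 <= t -> opnorm_le (fun v : 'cV_n => E t *m v) 1.
Implicit Types v : 'cV[R[i]]_n.

Lemma contr_le (t : R) v : 0 <= t -> nrm (E t *m v) <= nrm v.
Proof. by move=> t0; apply: le_trans (contr t0 v) _; rewrite mul1r. Qed.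

Lemma expmx0_mul v : E 0 *m v = v.
Proof.
apply/eqP; rewrite -subr_eq0; apply/eqP/nrm0_eq0/le_anti; rewrite nrm_ge0 andbT.
have := expmx_first_order v (lexx (0 : R)) (nrm_mulmx_le A (p := 1)).
by rewrite [0%:C *: (A *m v)]scale0r addr0 mul0r expR0 addr0 subrr mul0r.
Qed.

Lemma semigroup_increment (x y : R) v : 0 <= x -> x <= y ->
  E y *m v - E x *m v = E x *m (E (y - x) *m v - v).
Proof.
move=> x0 xy; have yE : y = x + (y - x) by rewrite addrC subrK.
have yx0 : 0 <= y - x by rewrite subr_ge0.
have Ey : E y = E x *m E (y - x) by rewrite [in LHS]yE; exact: expmxD.
by rewrite Ey mulmxBr mulmxA.
Qed.

(** By the semigroup law a short increment is [E x] applied to [E (y - x) v - v], so contractivity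
    bounds its slope by [nrm (A *m v)] up to a small error. The length [r] of a short increment
    depends on the matrix, but the mean value argument removes it from the result. *)
Lemma semigroup_sub1_le (t : R) v : 0 <= t ->
  nrm (E t *m v - v) <= t * nrm (A *m v).
Proof.
move=> t0; apply/ler_addgt0Pr => e e0; rewrite mulrC.
have e1 : 0 < e / (t + 1) by rewrite divr_gt0// ltr_wpDl.
have [r r0 step] := expmx_step A v e1.
apply: (@le_trans _ _ ((nrm (A *m v) + e / (t + 1)) * t)); last first.
  rewrite mulrDl lerD2l -mulrA ler_piMr ?(ltW e0)// mulrC ler_pdivrMr ?mul1r ?lerDl//.
  by rewrite ltr_wpDl.
rewrite -[X in _ - X]expmx0_mul.
apply: (small_step_le (phi := fun x => E x *m v) t0 r0) => x y x0 xy yt yxr.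
rewrite (semigroup_increment _ x0 xy); apply: le_trans (contr_le _ x0) _.
have -> : E (y - x) *m v - v = (E (y - x) *m v - (v + (y - x)%:C *: (A *m v)))
    + (y - x)%:C *: (A *m v) by rewrite opprD !addrA subrK.
apply: le_trans (nrmD _ _) _; rewrite addrC mulrDl; apply: lerD.
  by rewrite nrmZr ger0_norm ?subr_ge0// mulrC.
by apply: step; rewrite ?subr_ge0.
Qed.

(** Subtracting the tangent leaves the slope [E x (A v) - A v], which the previous lemma, applied to
    [A v], bounds by [t] times the norm of [A (A v)]. *)
Lemma semigroup_taylor1_le (t : R) v : 0 <= t ->
  nrm (E t *m v - v - t%:C *: (A *m v)) <= t ^+ 2 * nrm (A *m (A *m v)).
Proof.
move=> t0; apply/ler_addgt0Pr => e e0.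
have e1 : 0 < e / (t + 1) by rewrite divr_gt0// ltr_wpDl.
have [r r0 step] := expmx_step A v e1.
set w := A *m v; set c := nrm (A *m w).
apply: (@le_trans _ _ ((t * c + e / (t + 1)) * t)); last first.
  rewrite mulrDl expr2 [t * c * t]mulrAC lerD2l -mulrA ler_piMr ?(ltW e0)// mulrC ler_pdivrMr ?mul1r ?lerDl//.
  by rewrite ltr_wpDl.
pose phi x := E x *m v - x%:C *: w.
have phi0 : phi 0 = v by rewrite /phi [E 0 *m v]expmx0_mul [0%:C *: w]scale0r subr0.
have -> : E t *m v - v - t%:C *: w = phi t - phi 0 by rewrite phi0 addrAC.
apply: (small_step_le t0 r0) => x y x0 xy yt yxr.
have -> : phi y - phi x = E x *m (E (y - x) *m v - (v + (y - x)%:C *: w))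
    + (y - x)%:C *: (E x *m w - w).
  have -> : phi y - phi x = E y *m v - E x *m v - (y - x)%:C *: w.
    rewrite /phi rmorphB/= scalerBl !opprB addrACA [RHS]addrACA.
    by congr (_ + _); rewrite addrC.
  apply: etrans (split_taylor_increment (E x) (E (y - x)) v w (y - x)%:C).
  by congr (_ - _); exact: semigroup_increment.
apply: le_trans (nrmD _ _) _; rewrite addrC mulrDl; apply: lerD.
  rewrite nrmZr ger0_norm ?subr_ge0// mulrC ler_wpM2r ?subr_ge0//.
  apply: le_trans (semigroup_sub1_le _ x0) _.
  by rewrite ler_wpM2r ?nrm_ge0// (le_trans xy).
by apply: le_trans (contr_le _ x0) _; apply: step; rewrite ?subr_ge0.
Qed.

End ContractionSemigroup.

(** * Stability of the error recursion *)

Lemma discrete_gronwall (R : realType) (y : nat -> R) (k C D : R) n :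
  0 <= k -> 0 <= C -> 0 <= D -> 0 <= y 0%N ->
  (forall m, (m < n)%N -> y m.+1 <= (1 + k * C) * y m + k * D) ->
  y n <= expR (n%:R * k * C) * (y 0%N + n%:R * k * D).
Proof.
move=> k0 C0 D0 y0; elim: n => [|n IH] step.
  by rewrite !mul0r addr0 expR0 mul1r.
have {}IH := IH (fun m mn => step m (ltnW mn)).
apply: le_trans (step n (ltnSn n)) _.
have kC : 0 <= 1 + k * C by rewrite addr_ge0// mulr_ge0.
have z0 : 0 <= y 0%N + n%:R * k * D by rewrite addr_ge0// !mulr_ge0.
have eS : expR (n.+1%:R * k * C) = expR (k * C) * expR (n%:R * k * C).
  by rewrite -expRD; congr expR; rewrite -[n.+1]add1n natrD; ring.
have -> : y 0%N + n.+1%:R * k * D = (y 0%N + n%:R * k * D) + k * D.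
  by rewrite -[n.+1]addn1 natrD; ring.
rewrite mulrDr; apply: lerD.
  apply: (le_trans (ler_wpM2l kC IH)); rewrite mulrA eS.
  by rewrite ler_wpM2r// ler_wpM2r ?expR_ge0// expR_ge1Dx.
rewrite -[leLHS]mul1r ler_wpM2r ?mulr_ge0//.
by apply: le_trans (expR_ge1Dx _); rewrite lerDl !mulr_ge0.
Qed.

Section Stability.
Variables (R : realType) (n : nat).

(** Summation by parts as an induction that removes the first term and shifts [w]: replacing [w 0]
    by [w 1] in front of the remaining partial sum of [Q] costs one increment of [w] times [C]. *)
Lemma abel_bound (Q : nat -> 'M[R[i]]_n) (w : nat -> 'cV[R[i]]_n) (C D : R) m :
  0 <= C ->
  (forall l, (l <= m.+1)%N ->
    opnorm_le (fun v : 'cV_n => (\sum_(1 <= r < l) Q r) *m v) C) ->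
  (forall j, (j < m)%N -> nrm (w j.+1 - w j) <= D) ->
  nrm (\sum_(0 <= j < m) Q (m - j)%N *m w j - (\sum_(1 <= r < m.+1) Q r) *m w 0%N)
    <= m%:R * (C * D).
Proof.
move=> C0; elim: m w => [|m IH] w QC wD.
  by rewrite !big_geq// mul0mx subrr nrm0 mul0r.
rewrite big_nat_recl//= subn0 [X in _ - X *m _]big_nat_recr//= mulmxDl.
under eq_big_nat => j _ do rewrite subSS.
set Sm := \sum_(1 <= r < m.+1) Q r; set Z := \sum_(0 <= j < m) _.
have -> : Q m.+1 *m w 0%N + Z - (Sm *m w 0%N + Q m.+1 *m w 0%N) =
    (Z - Sm *m w 1%N) + Sm *m (w 1%N - w 0%N).
  rewrite mulmxBr [Q _ *m _ + Z]addrC opprD addrA [Z + _ - _]addrAC addrK.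
  by rewrite addrA subrK.
apply: le_trans (nrmD _ _) _.
rewrite -[m.+1]addn1 natrD mulrDl mul1r; apply: lerD.
  apply: (IH (fun j => w j.+1)) => [l lm|j jm]; last exact: wD.
  by apply: QC; exact: leqW.
apply: le_trans (QC _ _ _) _; first exact: leqnSn.
by rewrite ler_wpM2l// wD.
Qed.

Lemma stability (P B : 'M[R[i]]_n) (Q : nat -> 'M[R[i]]_n)
    (k T C C1 C2 C3 eta : R) (e N w : nat -> 'cV[R[i]]_n) m :
  (forall v : 'cV_n, nrm (P *m v) <= nrm v) ->
  (forall r, P *m Q r = Q r.+1) -> P *m B = Q 1%N ->
  0 < k -> m%:R * k <= T -> 0 <= C -> 0 <= C1 -> 0 <= C3 -> 0 <= eta ->
  C2 = T * C * C1 + C * C1 + C1 ->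
  (forall l, (l <= m)%N ->
    opnorm_le (fun v : 'cV_n => (\sum_(1 <= r < l) Q r) *m v) C) ->
  (forall j, (j < m)%N -> e j.+1 = P *m e j + B *m w j + N j) ->
  (forall j, (j < m)%N -> nrm (w j) <= C1 * k) ->
  (forall j, (j.+1 < m)%N -> nrm (w j.+1 - w j) <= C1 * k ^+ 2) ->
  (forall j, (j < m)%N -> nrm (B *m w j) <= C1 * k) ->
  (forall j, (j < m)%N -> nrm (N j) <= k * C3 * (nrm (e j) + k + eta)) ->
  nrm (e 0%N) <= C3 * eta ->
  nrm (e m) <= (expR (T * C3) * (C3 + T * C3 * (1 + C2)) + C2) * (k + eta).
Proof.
move=> contr PQ PB k0 mT C0 C10 C30 eta0 C2E QC rec wk dw Bw Nb e0b.
have T0 : 0 <= T by rewrite (le_trans _ mT)// mulr_ge0// ltW.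
have C20 : 0 <= C2.
  by rewrite C2E; apply: addr_ge0 => //; apply: addr_ge0; rewrite !mulr_ge0.
(* [X] solves [X_{j+1} = P X_j + B w_j] from [X_0 = 0], so [e - X] is driven by [N] alone. The
   newest term [B w_j] stays apart because the bounded sums of [Q] start at index 1, that is, with
   at least one factor [P]. *)
pose PX j := \sum_(0 <= l < j) Q (j - l)%N *m w l.
pose X j := if j is j'.+1 then PX j' + B *m w j' else 0.
have EX j : P *m X j = PX j.
  case: j => [|j]; first by rewrite /X /PX mulmx0 big_geq.
  rewrite /X mulmxDr mulmxA PB /PX [RHS]big_nat_recr//= subSnn mulmx_sumr.
  congr (_ + _); apply: eq_big_nat => l /andP[_ lj].
  by rewrite mulmxA PQ subSn// ltnW.
have Xb j : (j <= m)%N -> nrm (X j) <= C2 * k.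
  case: j => [_|j jm]; first by rewrite nrm0 mulr_ge0// ltW.
  (* The three summands of [C2]: at most [T / k] increments of size [C1 k^2], the boundary term with
     [w 0], and the newest term. *)
  apply: le_trans (nrmD _ _) _; rewrite C2E mulrDl; apply: lerD; last exact: Bw.
  rewrite -[PX j](subrK ((\sum_(1 <= r < j.+1) Q r) *m w 0%N)).
  apply: le_trans (nrmD _ _) _; rewrite mulrDl; apply: lerD.
    apply: le_trans (abel_bound (C := C) (D := C1 * k ^+ 2) _ _ _) _ => //.
    - by move=> l lj; apply: QC; exact: leq_trans jm.
    - by move=> l lj; apply: dw; exact: leq_trans jm.
    have -> : j%:R * (C * (C1 * k ^+ 2)) = (j%:R * k) * (C * C1 * k) by ring.
    have -> : T * C * C1 * k = T * (C * C1 * k) by ring.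
    apply: ler_wpM2r; first by rewrite !mulr_ge0// ltW.
    by apply: le_trans mT; rewrite ler_wpM2r ?(ltW k0)// ler_nat ltnW.
  apply: le_trans (QC _ jm _) _; rewrite -mulrA ler_wpM2l//.
  by apply: wk; exact: leq_trans jm.
pose y j := nrm (e j - X j).
have eb j : (j <= m)%N -> nrm (e j) <= y j + C2 * k.
  move=> jm; rewrite -[e j](subrK (X j)); apply: le_trans (nrmD _ _) _.
  by rewrite lerD2l Xb.
have ystep j : (j < m)%N ->
    y j.+1 <= (1 + k * C3) * y j + k * (C3 * (1 + C2) * (k + eta)).
  move=> jm; have -> : y j.+1 = nrm (P *m (e j - X j) + N j).
    rewrite /y rec// mulmxBr EX /X; congr nrm; move: (P *m _) (B *m _) (PX j) (N j).
    by move=> p q r z; rewrite opprD addrA [RHS]addrAC [LHS]addrAC; congr (_ - _);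
    rewrite [p + q + z]addrAC addrK.
  apply: le_trans (nrmD _ _) _.
  apply: le_trans (lerD (contr _) (Nb _ jm)) _.
  rewrite [X in _ <= X + _]mulrDl mul1r -[leRHS]addrA lerD2l.
  apply: (@le_trans _ _ (k * C3 * (y j + C2 * k + k + eta))).
    by rewrite ler_wpM2l ?mulr_ge0 ?(ltW k0)// !lerD2r eb// ltnW.
  rewrite -subr_ge0.
  have -> : k * C3 * y j + k * (C3 * (1 + C2) * (k + eta)) -
     k * C3 * (y j + C2 * k + k + eta) = k * C3 * C2 * eta by ring.
  by rewrite !mulr_ge0// ltW.
have ke0 : 0 <= k + eta by rewrite addr_ge0// ltW.
have D0 : 0 <= C3 * (1 + C2) * (k + eta) by rewrite !mulr_ge0// addr_ge0.
have y0 : y 0%N <= C3 * (k + eta).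
  rewrite /y subr0 (le_trans e0b)// ler_wpM2l// lerDr ltW//.
apply: le_trans (eb m (leqnn m)) _; rewrite mulrDl; apply: lerD; last first.
  by rewrite ler_wpM2l// lerDl.
apply: le_trans (discrete_gronwall (ltW k0) C30 D0 (nrm_ge0 _) ystep) _.
rewrite -[leRHS]mulrA; apply: ler_pM; rewrite ?expR_ge0//.
- by rewrite addr_ge0 ?nrm_ge0// mulr_ge0// mulr_ge0// ltW.
- by rewrite ler_expR ler_wpM2r.
rewrite mulrDl; apply: lerD => //.
by rewrite -!mulrA mulrA ler_wpM2r// !mulr_ge0// addr_ge0.
Qed.

End Stability.

(** * The error of the Lawson method *)

(** Because the weights sum to one, [kap *: F] can be moved inside the quadrature sum; together with
    [v = Ar + F] this separates the linear defect of the exact data from the stage errors, the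
    Taylor remainder of [p] and the increment of [p - r]. *)
Lemma error_recursion_identity (K : comNzRingType) (n s : nat) (P : 'M[K]_n)
    (E : 'I_s -> 'M[K]_n) (phi : 'I_s -> 'cV[K]_n) (beta : 'I_s -> K) (kap : K)
    (U r Ar F p p' r' v : 'cV[K]_n) :
  \sum_(i < s) beta i = 1 -> v = Ar + F ->
  P *m U + kap *: \sum_(i < s) beta i *: (E i *m phi i) - r' =
  P *m (U - r)
  + ((P *m r - r - kap *: Ar) + kap *: \sum_(i < s) beta i *: (E i *m F - F))
  + (kap *: \sum_(i < s) beta i *: (E i *m (phi i - F))
     - (p' - p - kap *: v) + ((p' - r') - (p - r))).
Proof.
move=> b1 ->.
have -> : \sum_(i < s) beta i *: (E i *m F - F) =
    \sum_(i < s) beta i *: (E i *m F) - F.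
  under eq_bigr do rewrite scalerBr.
  by rewrite big_split/= sumrN -scaler_suml b1 scale1r.
have -> : \sum_(i < s) beta i *: (E i *m (phi i - F)) =
    \sum_(i < s) beta i *: (E i *m phi i) - \sum_(i < s) beta i *: (E i *m F).
  under eq_bigr do rewrite mulmxBr scalerBr.
  by rewrite big_split/= sumrN.
rewrite mulmxBr; move: (\sum_(i < s) _) (\sum_(i < s) _) (P *m U) (P *m r).
by move=> x y z w; apply/matrixP => i j; rewrite !mxE; ring.
Qed.

(** [C1] controls [w_n], its increments and the single terms [k A w_n]; [C2] their accumulated
    effect; [C3] the perturbation, with [1 + 2 * M + M * M] coming from the stage errors. The last
    [M] pays for returning from [r] to [p]. *)
Definition lawson_constant (R : realType) (T M : R) : R :=
  let C1 := 2 * M + 2 * M * M in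
  let C2 := T * M * C1 + M * C1 + C1 in
  let C3 := M * (M * (1 + 2 * M + M * M) + M) + 2 * M in
  expR (T * C3) * (C3 + T * C3 * (1 + C2)) + C2 + M.

Section LawsonError.
Variables (R : realType) (n s : nat) (a : 'I_s -> 'I_s -> R) (b c : 'I_s -> R).
Variables (A : 'M[R[i]]_n) (E : R -> 'M[R[i]]_n).
Hypothesis Aunit : A \in unitmx.
Hypothesis Econtr : forall (t : R) (v : 'cV_n), 0 <= t -> nrm (E t *m v) <= nrm v.
Hypothesis Ecomm : forall t, A *m E t = E t *m A.
Hypothesis ED : forall t t', 0 <= t -> 0 <= t' -> E (t + t') = E t *m E t'.
Hypothesis Esub1 : forall (t : R) (v : 'cV_n), 0 <= t ->
  nrm (E t *m v - v) <= t * nrm (A *m v).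
Hypothesis Etaylor : forall (t : R) (v : 'cV_n), 0 <= t ->
  nrm (E t *m v - v - t%:C *: (A *m v)) <= t ^+ 2 * nrm (A *m (A *m v)).
Hypothesis adm : admissible_tableau a c.

(* [k A (weight k zr zF)] is the part of the local error that is only O(k), with
   zr and zF standing for the images under A^-1 of R_h u and of P_h f(t, u). *)
Definition weight (k : R) (zr zF : 'cV[R[i]]_n) : 'cV[R[i]]_n :=
  (k^-1)%:C *: (E k *m zr - zr - k%:C *: (A *m zr))
  + \sum_(i < s) (b i)%:C *: (E ((1 - c i) * k) *m zF - zF).

(** Linearity turns the size estimate of [weight] into an estimate of its increments. *)
Lemma weightB k zr zF zr' zF' :
  weight k zr zF - weight k zr' zF' = weight k (zr - zr') (zF - zF').
Proof.
rewrite /weight opprD addrACA -scalerBr -sumrB; congr (_ *: _ + _).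
  rewrite !mulmxBr !scalerBr; move: (E k *m _) (E k *m _) (_ *: _) (_ *: _).
  by move=> x y z w; apply/matrixP => i j; rewrite !mxE; ring.
apply: eq_bigr => i _; rewrite -scalerBr mulmxBr; congr (_ *: _).
by rewrite !opprB addrACA [RHS]addrACA; congr (_ + _); rewrite addrC.
Qed.

Lemma stage_ge0 (k : R) i : 0 <= k -> 0 <= (1 - c i) * k.
Proof.
by move=> k0; have /andP[_ c1] := adm.1 i; rewrite mulr_ge0// subr_ge0.
Qed.

Lemma stage_le (k : R) i : 0 <= k -> (1 - c i) * k <= k.
Proof.
by move=> k0; have /andP[c0 _] := adm.1 i; rewrite ler_piMl// gerBl.
Qed.

(** The division by [k] uses up one of the two powers of the second-order remainder in [zr]. For
    [zr = A^-1 r] and [zF = A^-1 F] the right-hand side involves just [A r] and [F]. *)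
Lemma weight_le (k : R) zr zF : 0 < k ->
  nrm (weight k zr zF) <=
    k * nrm (A *m (A *m zr)) + (\sum_(i < s) `|b i|) * k * nrm (A *m zF).
Proof.
move=> k0; apply: le_trans (nrmD _ _) _; apply: lerD.
  rewrite nrmZr ger0_norm ?invr_ge0 ?(ltW k0)// mulrC ler_pdivrMr//.
  apply: le_trans (Etaylor _ (ltW k0)) _.
  by rewrite expr2 -!mulrA ler_wpM2l ?(ltW k0)// mulrC.
apply: le_trans (nrm_sum _ _ _) _; rewrite -mulrA mulr_suml; apply: ler_sum => i _.
rewrite nrmZr ler_wpM2l//; apply: le_trans (Esub1 _ (stage_ge0 i (ltW k0))) _.
by rewrite ler_wpM2r ?nrm_ge0// stage_le// ltW.
Qed.

Lemma mul_weight (k : R) r F : 0 < k ->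
  (k%:C *: A) *m weight k (invmx A *m r) (invmx A *m F) =
  (E k *m r - r - k%:C *: (A *m r))
  + k%:C *: \sum_(i < s) (b i)%:C *: (E ((1 - c i) * k) *m F - F).
Proof.
move=> k0; have kk : k%:C * (k^-1)%:C = 1 :> R[i].
  by rewrite -rmorphM/= mulfV ?gt_eqF.
have AEi t v : A *m (E t *m (invmx A *m v)) = E t *m v.
  by rewrite mulmxA Ecomm -mulmxA mulKVmx.
rewrite -scalemxAl /weight mulmxDr scalerDr -scalemxAr scalerA kk scale1r.
congr (_ + _).
  by rewrite !mulmxBr AEi mulKVmx// -scalemxAr.
congr (_ *: _); rewrite mulmx_sumr; apply: eq_bigr => i _.
by rewrite -scalemxAr mulmxBr AEi mulKVmx.
Qed.

(** With [A] in front no second-order remainder is available: [r] is estimated to first order and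
    [F] by contractivity alone. This serves for the one newest term left out of the summation by
    parts. *)
Lemma mul_weight_le (k : R) r F : 0 < k ->
  nrm ((k%:C *: A) *m weight k (invmx A *m r) (invmx A *m F)) <=
  2 * k * nrm (A *m r) + 2 * k * (\sum_(i < s) `|b i|) * nrm F.
Proof.
move=> k0; rewrite mul_weight//; apply: le_trans (nrmD _ _) _; apply: lerD.
  apply: le_trans (nrmD _ _) _; rewrite nrmN nrmZr (gtr0_norm k0).
  by rewrite -mulrA mulr_natl mulr2n lerD2r Esub1// ltW.
rewrite nrmZr (gtr0_norm k0) [2 * k]mulrC -!mulrA ler_wpM2l ?(ltW k0)//.
apply: le_trans (nrm_sum _ _ _) _; rewrite mulrCA mulr_suml; apply: ler_sum => i _.
rewrite nrmZr ler_wpM2l// mulr_natl mulr2n.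
by apply: le_trans (nrmD _ _) _; rewrite nrmN lerD2r Econtr// stage_ge0// ltW.
Qed.

Variables (T M eta k : R) (p r F v : R -> 'cV[R[i]]_n).
Variables (U : nat -> 'cV[R[i]]_n) (K phi : nat -> 'I_s -> 'cV[R[i]]_n) (m : nat).
Hypotheses (M0 : 0 <= M) (eta0 : 0 <= eta) (k0 : 0 < k) (mT : m%:R * k <= T).
Let inT (t : R) := 0 <= t <= T.
Hypothesis vE : forall t, inT t -> v t = A *m r t + F t.
Hypothesis ArM : forall t, inT t -> nrm (A *m r t) <= M.
Hypothesis ArL : forall t t', inT t -> inT t' ->
  nrm (A *m (r t' - r t)) <= M * `|t' - t|.
Hypothesis FM : forall t, inT t -> nrm (F t) <= M.
Hypothesis FL : forall t t', inT t -> inT t' -> nrm (F t' - F t) <= M * `|t' - t|.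
Hypothesis pL : forall t t', inT t -> inT t' -> nrm (p t' - p t) <= M * `|t' - t|.
Hypothesis pTaylor : forall t, 0 <= t -> t + k <= T ->
  nrm (p (t + k) - p t - k%:C *: v t) <= M * k ^+ 2.
Hypothesis prM : forall t, inT t -> nrm (p t - r t) <= eta * M.
Hypothesis prL : forall t t', inT t -> inT t' ->
  nrm ((p t' - r t') - (p t - r t)) <= eta * (M * `|t' - t|).
Hypothesis bM : \sum_(i < s) `|b i| <= M.
Hypothesis aM : forall i : 'I_s, \sum_(j < s | (j < i)%N) `|a i j| <= M.
Hypothesis b1 : \sum_(i < s) b i = 1.
Hypothesis U0 : U 0%N = p 0.
Hypothesis US : forall j, (j < m)%N ->
  U j.+1 = E k *m U j
    + k%:C *: \sum_(i < s) (b i)%:C *: (E ((1 - c i) * k) *m phi j i).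
Hypothesis KE : forall j (i : 'I_s), (j < m)%N ->
  K j i = E (c i * k) *m U j
    + k%:C *: \sum_(l < s | (l < i)%N) (a i l)%:C *: (E ((c i - c l) * k) *m phi j l).
Hypothesis phiM : forall j i, (j < m)%N -> nrm (phi j i) <= M.
Hypothesis phiL : forall j i, (j < m)%N ->
  nrm (phi j i - F (j%:R * k + c i * k)) <= M * nrm (K j i - p (j%:R * k + c i * k)).
Hypothesis sumM : forall l, (l <= m)%N -> opnorm_le (fun x : 'cV_n =>
  (k%:C *: (A *m \sum_(1 <= q < l) E (q%:R * k))) *m x) M.

Lemma step_in j : (j < m)%N -> 0 <= j%:R * k /\ j%:R * k + k <= T.
Proof.
move=> jm; split; first by rewrite mulr_ge0// ltW.
apply: le_trans mT; have -> : j%:R * k + k = j.+1%:R * k.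
  by rewrite -[j.+1]addn1 natrD mulrDl mul1r.
by rewrite ler_wpM2r ?(ltW k0)// ler_nat.
Qed.

Lemma time_in j : (j < m)%N -> inT (j%:R * k).
Proof.
move=> /step_in[t0 tk]; rewrite /inT t0/= (le_trans _ tk)// lerDl.
exact: ltW.
Qed.

Lemma stage_time_in j i : (j < m)%N -> inT (j%:R * k + c i * k).
Proof.
have /andP[c0 c1] := adm.1 i; move=> /step_in[t0 tk].
rewrite /inT addr_ge0 ?mulr_ge0// ?(ltW k0)//=.
by rewrite (le_trans _ tk)// lerD2l ler_piMl// ltW.
Qed.

Lemma stage_error j i : (j < m)%N ->
  nrm (K j i - p (j%:R * k + c i * k)) <=
    (1 + 2 * M + M * M) * (nrm (U j - r (j%:R * k)) + k + eta).
Proof.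
move=> jm; have /andP[c0 c1] := adm.1 i.
have tT := time_in jm; have tiT := stage_time_in i jm.
set t := j%:R * k in tT tiT *; set t' := t + c i * k in tiT *.
have ck0 : 0 <= c i * k by rewrite mulr_ge0// ltW.
have ckk : c i * k <= k by rewrite ler_piMl// ltW.
rewrite KE//; set S := \sum_(l < s | _) _.
(* The pieces are the propagated error, the motion of [r] under the semigroup, the projection error,
   the motion of [p], and the stage sum, which is [O(k)] because the values [phi] are bounded. *)
have -> : E (c i * k) *m U j + k%:C *: S - p t' =
    E (c i * k) *m (U j - r t) + (E (c i * k) *m r t - r t)
    - (p t - r t) - (p t' - p t) + k%:C *: S.
  rewrite mulmxBr; move: (E _ *m U j) (E _ *m r t) (_ *: S) => x y z.
  by apply/matrixP => q q'; rewrite !mxE; ring.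
have h1 := Econtr (U j - r t) ck0.
have h2 : nrm (E (c i * k) *m r t - r t) <= k * M.
  apply: le_trans (Esub1 _ ck0) _.
  by apply: ler_pM; rewrite ?nrm_ge0// ArM.
have h3 := prM tT.
have h4 : nrm (p t' - p t) <= M * k.
  apply: le_trans (pL tT tiT) _; rewrite ler_wpM2l// /t' addrAC subrr add0r.
  by rewrite ger0_norm.
have h5 : nrm (k%:C *: S) <= k * (M * M).
  rewrite nrmZr (gtr0_norm k0) ler_wpM2l ?(ltW k0)//.
  apply: le_trans (nrm_sum _ _ _) _.
  apply: (@le_trans _ _ ((\sum_(l < s | (l < i)%N) `|a i l|) * M)); last first.
    by rewrite ler_wpM2r.
  rewrite mulr_suml; apply: ler_sum => l li; rewrite nrmZr.
  (* The ordering [c l <= c i], needed for contractivity at time [(c i - c l) * k], is guaranteed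
     only for nonzero coefficients. *)
  have [->|al0] := eqVneq (a i l) 0; first by rewrite normr0 !mul0r.
  rewrite ler_wpM2l//; apply: le_trans (phiM l jm); apply: Econtr.
  by rewrite mulr_ge0 ?(ltW k0)// subr_ge0 (adm.2 _ _ li al0).
set e := nrm (U j - r t) in h1 *.
have e0 : 0 <= e := nrm_ge0 _.
apply: (@le_trans _ _ ((e + k * M + eta * M + M * k) + k * (M * M))).
  apply: (le_trans (nrmD _ _)); apply: lerD h5.
  apply: (le_trans (nrmD _ _)); rewrite nrmN; apply: lerD h4.
  apply: (le_trans (nrmD _ _)); rewrite nrmN; apply: lerD h3.
  by apply: (le_trans (nrmD _ _)); exact: lerD h1 h2.
rewrite -subr_ge0.
have -> : (1 + 2 * M + M * M) * (e + k + eta)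
    - (e + k * M + eta * M + M * k + k * (M * M))
  = k + eta + 2 * M * e + M * eta + M * M * (e + eta) by ring.
by rewrite !(addr_ge0, mulr_ge0) ?(ltW k0).
Qed.

Let defect j : 'cV[R[i]]_n := let t := j%:R * k in
  k%:C *: \sum_(i < s) (b i)%:C *: (E ((1 - c i) * k) *m (phi j i - F t))
  - (p (t + k) - p t - k%:C *: v t)
  + ((p (t + k) - r (t + k)) - (p t - r t)).

Lemma defect_le j : (j < m)%N ->
  nrm (defect j) <= k * (M * (M * (1 + 2 * M + M * M) + M) + 2 * M)
    * (nrm (U j - r (j%:R * k)) + k + eta).
Proof.
move=> jm; have [t0 tk] := step_in jm; have tT := time_in jm.
rewrite /defect; set t := j%:R * k in t0 tk tT *.
have tkT : inT (t + k) by rewrite /inT addr_ge0 ?(ltW k0).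
set e := nrm (U j - r t); set C4 := 1 + 2 * M + M * M.
have e0 : 0 <= e := nrm_ge0 _.
have C40 : 0 <= C4 by rewrite !addr_ge0 ?mulr_ge0.
have h1 : nrm (k%:C *: \sum_(i < s) (b i)%:C *: (E ((1 - c i) * k) *m (phi j i - F t)))
    <= k * (M * ((M * C4 + M) * (e + k + eta))).
  rewrite nrmZr (gtr0_norm k0) ler_wpM2l ?(ltW k0)//.
  apply: le_trans (nrm_sum _ _ _) _.
  have g0 : 0 <= (M * C4 + M) * (e + k + eta).
    by rewrite !(mulr_ge0, addr_ge0)// ltW.
  apply: (@le_trans _ _ ((\sum_(i < s) `|b i|) * ((M * C4 + M) * (e + k + eta)))); last first.
    by rewrite ler_wpM2r.
  rewrite mulr_suml; apply: ler_sum => i _; rewrite nrmZr ler_wpM2l//.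
  apply: le_trans (Econtr _ (stage_ge0 i (ltW k0))) _.
  (* Passing through [F] at the stage time separates the stage error, handled by the Lipschitz bound
     in the tube, from the variation of [F] over at most one step. *)
  rewrite -[phi j i](subrK (F (t + c i * k))) -addrA.
  apply: le_trans (nrmD _ _) _.
  apply: le_trans (lerD (phiL i jm) (FL tT (stage_time_in i jm))) _.
  have := ler_wpM2l M0 (stage_error i jm); rewrite -/t -/e -/C4 => h.
  apply: le_trans (lerD h (lexx _)) _.
  rewrite -mulrDr [leRHS]mulrDl -[X in _ <= X + _]mulrA -[leRHS]mulrDr.
  rewrite ler_wpM2l// lerD2l.
  have /andP[c0 c1] := adm.1 i.
  rewrite addrAC subrr add0r ger0_norm ?mulr_ge0 ?(ltW k0)//.
  apply: (@le_trans _ _ k); first by rewrite ler_piMl// ltW.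
  by rewrite -addrA addrCA lerDl addr_ge0.
have h2 := pTaylor t0 tk.
have h3 : nrm ((p (t + k) - r (t + k)) - (p t - r t)) <= eta * (M * k).
  by apply: le_trans (prL tT tkT) _; rewrite [t + k]addrC addrK (gtr0_norm k0).
apply: (@le_trans _ _ (k * (M * ((M * C4 + M) * (e + k + eta))) + M * k ^+ 2 + eta * (M * k))).
  apply: (le_trans (nrmD _ _)); apply: lerD h3.
  by apply: (le_trans (nrmD _ _)); rewrite nrmN; exact: lerD h1 h2.
rewrite -subr_ge0.
set G := M * C4 + M.
have -> : k * (M * G + 2 * M) * (e + k + eta)
    - (k * (M * (G * (e + k + eta))) + M * k ^+ 2 + eta * (M * k))
  = k * M * (2 * e + k + eta) by ring.
by rewrite !(mulr_ge0, addr_ge0) ?(ltW k0).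
Qed.

Lemma lawson_error_le : nrm (U m - p (m%:R * k)) <= lawson_constant T M * (eta + k).
Proof.
rewrite /lawson_constant; set C1 := 2 * M + 2 * M * M.
set C2 := T * M * C1 + M * C1 + C1; set C3 := M * _ + 2 * M.
have T0 : 0 <= T by rewrite (le_trans _ mT)// mulr_ge0// ltW.
have C10 : 0 <= C1 by rewrite !(addr_ge0, mulr_ge0).
have C30 : 0 <= C3 by rewrite !(addr_ge0, mulr_ge0).
pose zr (j : nat) := invmx A *m r (j%:R * k).
pose zF (j : nat) := invmx A *m F (j%:R * k).
have Azr (j : nat) : A *m zr j = r (j%:R * k) by rewrite mulKVmx.
have AzF (j : nat) : A *m zF j = F (j%:R * k) by rewrite mulKVmx.
have tS (j : nat) : j.+1%:R * k = j%:R * k + k.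
  by rewrite -[j.+1]addn1 natrD mulrDl mul1r.
have dt (j : nat) : `|j.+1%:R * k - j%:R * k| = k.
  by rewrite tS addrAC subrr add0r gtr0_norm.
have k00 := ltW k0.
have in0 : inT 0 by rewrite /inT lexx.
have inm : inT (m%:R * k) by rewrite /inT mulr_ge0.
(* The scheme starts from [p 0], so the error against [r] begins with the projection error; [C3] is
   at least [M]. *)
have e0b : nrm (U 0%N - r (0%:R * k)) <= C3 * eta.
  rewrite U0 mul0r; apply: le_trans (prM in0) _; rewrite mulrC ler_wpM2r//.
  by rewrite /C3 mulr_natl mulr2n addrA lerDr !(addr_ge0, mulr_ge0).
have wk j : (j < m)%N -> nrm (weight k (zr j) (zF j)) <= C1 * k.
  move=> jm; apply: le_trans (weight_le _ _ k0) _; rewrite Azr AzF.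
  have tT := time_in jm.
  apply: (@le_trans _ _ (k * M + M * k * M)).
    apply: lerD; first by rewrite ler_wpM2l// ArM.
    by apply: ler_pM; rewrite ?mulr_ge0 ?nrm_ge0 ?sumr_ge0 ?FM// ler_wpM2r.
  rewrite -subr_ge0.
  have -> : C1 * k - (k * M + M * k * M) = M * k + M * M * k by rewrite /C1; ring.
  by rewrite !(addr_ge0, mulr_ge0).
have dw j : (j.+1 < m)%N ->
    nrm (weight k (zr j.+1) (zF j.+1) - weight k (zr j) (zF j)) <= C1 * k ^+ 2.
  move=> jm; rewrite weightB; apply: le_trans (weight_le _ _ k0) _.
  rewrite !mulmxBr !Azr !AzF -mulmxBr.
  have tT := time_in (ltnW jm); have tT' := time_in jm.
  have h1 := ArL tT tT'; have h2 := FL tT tT'; rewrite dt in h1 h2.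
  apply: (@le_trans _ _ (k * (M * k) + M * k * (M * k))).
    apply: lerD; first by rewrite ler_wpM2l.
    by apply: ler_pM; rewrite ?mulr_ge0 ?nrm_ge0 ?sumr_ge0// ler_wpM2r.
  rewrite -subr_ge0.
  have -> : C1 * k ^+ 2 - (k * (M * k) + M * k * (M * k))
    = M * k * k + M * M * k * k by rewrite /C1; ring.
  by rewrite !(addr_ge0, mulr_ge0).
have Bw j : (j < m)%N -> nrm ((k%:C *: A) *m weight k (zr j) (zF j)) <= C1 * k.
  move=> jm; have tT := time_in jm; apply: le_trans (mul_weight_le _ _ k0) _.
  have -> : C1 * k = 2 * k * M + 2 * k * M * M by rewrite /C1; ring.
  apply: lerD; first by rewrite ler_wpM2l ?mulr_ge0// ArM.
  apply: ler_pM; rewrite ?mulr_ge0 ?nrm_ge0 ?sumr_ge0 ?FM//.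
  by rewrite ler_wpM2l ?mulr_ge0.
have rec j : (j < m)%N -> U j.+1 - r (j.+1%:R * k) =
    E k *m (U j - r (j%:R * k)) + (k%:C *: A) *m weight k (zr j) (zF j) + defect j.
  move=> jm; rewrite US// mul_weight// tS.
  have bC : \sum_(i < s) (b i)%:C = 1 :> R[i] by rewrite -rmorph_sum b1.
  exact: (error_recursion_identity (E k) (fun i => E ((1 - c i) * k)) (phi j) k%:C
    (U j) (r (j%:R * k)) (p (j%:R * k)) (p (j%:R * k + k)) (r (j%:R * k + k))
    bC (vE (time_in jm))).
(* By the semigroup law multiplication by [E k] shifts [Q], and the partial sums of [Q] are exactly
   the matrices bounded by [sumM]. *)
pose Q q := k%:C *: (A *m E (q%:R * k)).
have PQ q : E k *m Q q = Q q.+1.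
  have -> : Q q.+1 = k%:C *: (A *m (E k *m E (q%:R * k))).
    have qk0 : 0 <= q%:R * k by rewrite mulr_ge0.
    by rewrite /Q tS [_ + k]addrC (ED k00 qk0).
  by rewrite -scalemxAr [in LHS]mulmxA -[in LHS]Ecomm -[in LHS]mulmxA.
have PB : E k *m (k%:C *: A) = Q 1%N by rewrite /Q mul1r -scalemxAr Ecomm.
have QM l : (l <= m)%N ->
    opnorm_le (fun x : 'cV_n => (\sum_(1 <= q < l) Q q) *m x) M.
  by rewrite -scaler_sumr -mulmx_sumr; exact: sumM.
have := stability (fun x => Econtr x k00) PQ PB k0 mT M0 C10 C30 eta0
  (erefl C2) QM rec wk dw Bw defect_le e0b.
move=> h; have -> : U m - p (m%:R * k) = (U m - r (m%:R * k)) - (p (m%:R * k) - r (m%:R * k)).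
  by rewrite opprB addrA subrK.
apply: le_trans (nrmD _ _) _; rewrite nrmN mulrDl; apply: lerD.
  by rewrite [eta + k]addrC.
by apply: le_trans (prM inm) _; rewrite mulrC ler_wpM2l// lerDl.
Qed.

End LawsonError.

(** The statement for one mesh and one step size: the abstract family [E] becomes the matrix
    exponential, the boundary terms vanish, and the tube supplies bounds for the stage values of
    [f]. *)
Lemma lawson_global_error (R : realType) (s : nat) (a : 'I_s -> 'I_s -> R)
    (b c : 'I_s -> R) (Y : completeNormedModType R[i]) (n : nat)
    (A : 'M[R[i]]_n) (C : {linear Y -> 'cV[R[i]]_n}) (g : R -> Y)
    (f : R -> 'cV[R[i]]_n -> 'cV[R[i]]_n) (T M eta k delta : R)
    (p r F v : R -> 'cV[R[i]]_n) (m : nat) :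
  let U := lawson a b c A C g f k (p 0) in
  let inT (t : R) := 0 <= t <= T in
  A \in unitmx ->
  (forall t : R, 0 <= t ->
    opnorm_le (fun x : 'cV_n => expmx (t%:C *: A) *m x) 1) ->
  admissible_tableau a c ->
  0 <= M -> 0 <= eta -> 0 < k -> m%:R * k <= T ->
  (forall t, inT t -> v t = A *m r t + F t) ->
  (forall t, inT t -> nrm (A *m r t) <= M) ->
  (forall t t', inT t -> inT t' -> nrm (A *m (r t' - r t)) <= M * `|t' - t|) ->
  (forall t, inT t -> nrm (F t) <= M) ->
  (forall t t', inT t -> inT t' -> nrm (F t' - F t) <= M * `|t' - t|) ->
  (forall t t', inT t -> inT t' -> nrm (p t' - p t) <= M * `|t' - t|) ->
  (forall t, 0 <= t -> t + k <= T ->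
    nrm (p (t + k) - p t - k%:C *: v t) <= M * k ^+ 2) ->
  (forall t, inT t -> nrm (p t - r t) <= eta * M) ->
  (forall t t', inT t -> inT t' ->
    nrm ((p t' - r t') - (p t - r t)) <= eta * (M * `|t' - t|)) ->
  \sum_(i < s) `|b i| <= M ->
  (forall i : 'I_s, \sum_(j < s | (j < i)%N) `|a i j| <= M) ->
  \sum_(i < s) b i = 1 ->
  (forall t, inT t -> C (g t) = 0) ->
  (forall t x, inT t -> nrm (x - p t) <= delta -> nrm (f t x) <= M) ->
  (forall t x, inT t -> nrm (x - p t) <= delta ->
    nrm (f t x - F t) <= M * nrm (x - p t)) ->
  (forall j i, (j < m)%N ->
    nrm (lawson_stages a c A C g f k (j%:R * k) (U j) i
         - p (j%:R * k + c i * k)) <= delta) ->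
  (forall l, (l <= m)%N -> opnorm_le (fun x : 'cV_n =>
    (k%:C *: (A *m \sum_(1 <= q < l) expmx ((q%:R * k)%:C *: A))) *m x) M) ->
  nrm (U m - p (m%:R * k)) <= lawson_constant T M * (eta + k).
Proof.
move=> U inT Aunit contr adm M0 eta0 k0 mT vE ArM ArL FM FL pL pT prM prL bM aM b1
  Cg0 fM fL near_stages sumM.
pose K j i := lawson_stages a c A C g f k (j%:R * k) (U j) i.
pose phi j i := f (j%:R * k + c i * k) (K j i).
have inst j i : (j < m)%N -> inT (j%:R * k + c i * k).
  by move=> jm; exact: (stage_time_in adm k0 mT).
apply: (@lawson_error_le R n s a b c A (fun t => expmx (t%:C *: A)) Aunit
  _ _ _ _ _ adm T M eta k p r F v U K phi m M0 eta0 k0 mT vE ArM ArL FM FL pL pT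
  prM prL bM aM b1 _ _ _ _ _ sumM).
- by move=> t x t0; exact: contr_le.
- by move=> t; apply: expmx_comm; rewrite -scalemxAl -scalemxAr.
- by move=> t t'; exact: expmxD.
- by move=> t x; exact: semigroup_sub1_le.
- by move=> t x; exact: semigroup_taylor1_le.
- by [].
- move=> j jm; rewrite [LHS]/(lawson_step _ _ _ _ _ _ _ _ _ _) /lawson_step.
  congr (_ + _ *: _); apply: eq_bigr => i _.
  by rewrite Cg0 ?add0r//; exact: inst.
- move=> j i jm; rewrite /K lawson_stagesE /lawson_stage_map.
  congr (_ + _ *: _); apply: eq_bigr => l _.
  by rewrite Cg0 ?add0r//; exact: inst.
- by move=> j i jm; apply: fM; [exact: inst|exact: near_stages].
- by move=> j i jm; apply: fL; [exact: inst|exact: near_stages].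
Qed.

(** * Sampling on the grid and the uniform error bound *)

Section GridValues.
Variables (R : realType) (d : nat) (Om : bounded_domain R d) (n : nat).
Variable node : 'I_n -> closure Om.

Lemma grid_valuesB (x y : Cbar Om) :
  grid_values node (x - y) = grid_values node x - grid_values node y.
Proof. by apply/matrixP => i j; rewrite !mxE. Qed.

Lemma grid_valuesD (x y : Cbar Om) :
  grid_values node (x + y) = grid_values node x + grid_values node y.
Proof. by apply/matrixP => i j; rewrite !mxE. Qed.

Lemma grid_valuesZ a (x : Cbar Om) :
  grid_values node (a *: x) = a *: grid_values node x.
Proof. by apply/matrixP => i j; rewrite !mxE. Qed.

(** Sampling does not increase the maximum norm, so bounds proved once for the continuous problem
    hold on every grid with the same constants. *)
Lemma grid_values_le (x : Cbar Om) : nrm (grid_values node x) <= nrm x.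
Proof.
apply: nrm_mx_le => [|i j]; first exact: nrm_ge0.
by rewrite mxE; exact: nrm_le_Cbar_sup.
Qed.

End GridValues.

Theorem theorem3
  (R : realType) (d : nat) (Om : bounded_domain R d)
  (Y : completeNormedModType R[i])
  (T : R) (DA : set (Cbar Om)) (A : Cbar Om -> Cbar Om) (bd : Cbar Om -> Y)
  (f : R -> Cbar Om -> Cbar Om) (g : R -> Y)
  (S : R -> Cbar Om -> Cbar Om) (omega : \bar R)
  (u0 : Cbar Om) (u du : R -> Cbar Om)
  (Z : normedModType R[i]) (incl : {linear Z -> Cbar Om})
  (H : set R) (N : R -> nat) (node : forall h, 'I_(N h) -> closure Om)
  (Ah : forall h, 'M[R[i]]_(N h))
  (Ch : forall h, {linear Y -> 'cV[R[i]]_(N h)})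
  (Rh : forall h, Cbar Om -> 'cV[R[i]]_(N h))
  (fh : forall h, R -> 'cV[R[i]]_(N h) -> 'cV[R[i]]_(N h))
  (eps eta : R -> R)
  (s : nat) (a : 'I_s -> 'I_s -> R) (b c : 'I_s -> R) (kmax : R) :
  0 < T ->
  continuous_problem T DA A bd f g S omega u0 u ->
  space_discretization T DA A bd f S incl H node Ah Ch Rh fh eps eta ->
  admissible_tableau a c ->
  bounded_near_solution T H node Ah Ch g fh u a b c kmax ->
  (forall t : R, 0 <= t <= T -> g t = 0) ->
  \sum_(i < s) b i = 1 ->
  Ck T 3 u ->
  (exists uZ : R -> Z,
     (forall t : R, 0 <= t <= T -> incl (uZ t) = u t) /\ Ck T 1 uZ) ->
  derivative_on T u du ->
  (forall t : R, 0 <= t <= T -> DA (du t)) ->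
  (exists duZ : R -> Z,
     (forall t : R, 0 <= t <= T -> incl (duZ t) = du t) /\ Ck T 0 duZ) ->
  {within `[0, T], continuous (fun t => A (du t))} ->
  (exists C : R, forall (h k : R) (n : nat), H h -> 0 < k <= kmax ->
     n%:R * k <= T ->
     opnorm_le (fun V : 'cV[R[i]]_(N h) =>
       (k%:C *: (Ah h *m \sum_(1 <= r < n) expmx ((r%:R * k)%:C *: Ah h))) *m V)
       C) ->
  exists C h0 : R, 0 < h0 /\
    forall (h k : R) (n : nat), H h -> h < h0 -> 0 < k <= kmax -> n%:R * k <= T ->
      nrm (lawson a b c (Ah h) (Ch h) g (fh h) k (grid_values (node h) (u 0)) n
           - grid_values (node h) (u (n%:R * k)))
        <= C * (eta h + k).
Proof.
move=> T0 cp sd adm [delta [L [delta0 near]]] g0 b1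
  [v1 [du1 [v2 [dv1 Cv2]]]] [uZ [uZE CuZ]] _ _ _ _ [Cs HCs].
have T0' := ltW T0.
pose inT (t : R) := 0 <= t <= T.
pose G t := f t (u t).
have v1E t : inT t -> v1 t = A (u t) + G t.
  by move=> tT; exact: (derivative_on_unique T0 du1 (cp_ode cp) tT).
have [Lu [Lu0 uL]] := C1_lipschitz (cp_u cp).
(* The second derivative is itself [C^1], hence Lipschitz and bounded on the segment, which makes
   the first derivative Lipschitz. *)
have [Lv [Lv0 vL]] : exists Lv, 0 <= Lv /\ forall x y, inT x -> inT y ->
    nrm (v1 y - v1 x) <= Lv * `|y - x|.
  have [L2 [L20 v2L]] := C1_lipschitz Cv2.
  have [B2 [B20 v2B]] := lipschitz_bounded T0' L20 v2L.
  exists (B2 + 1); split; first by rewrite addr_ge0.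
  exact: derivative_bounded_lipschitz dv1 v2B.
have [LG [LG0 GL]] := C1_curve_lipschitz Lu0 (cp_f cp) uL.
have [BG [BG0 GB]] := lipschitz_bounded T0' LG0 GL.
(* The equation expresses [A u] through [u'] and [f(t, u)], so its Lipschitz bound in time follows
   without differentiating [A u]. *)
have AuE t : inT t -> A (u t) = v1 t - G t.
  by move=> tT; rewrite v1E// addrK.
have LA0 : 0 <= Lv + LG by rewrite addr_ge0.
have AL x y : inT x -> inT y -> nrm (A (u y) - A (u x)) <= (Lv + LG) * `|y - x|.
  move=> xT yT; rewrite !AuE//.
  have -> : v1 y - G y - (v1 x - G x) = (v1 y - v1 x) - (G y - G x).
    by rewrite !opprB addrACA [RHS]addrACA; congr (_ + _); rewrite addrC.
  apply: le_trans (nrmD _ _) _; rewrite nrmN mulrDl; apply: lerD.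
    exact: vL.
  exact: GL.
have [BA [BA0 AB]] := lipschitz_bounded T0' LA0 AL.
have [LZ [LZ0 ZL]] := C1_lipschitz CuZ.
have [BZ [BZ0 ZB]] := lipschitz_bounded T0' LZ0 ZL.
(* [L] and [Cs] are given without a sign, hence the absolute values; the 1 is the slack of
   [ball_lipschitz]. *)
pose Lf := `|L| + 1.
pose Sb := \sum_(i < s) `|b i|.
pose Sa := \sum_(i < s) \sum_(j < s | (j < i)%N) `|a i j|.
have Lf0 : 0 <= Lf by rewrite addr_ge0.
have Sb0 : 0 <= Sb by exact: sumr_ge0.
have Sa0 : 0 <= Sa by apply: sumr_ge0 => i _; exact: sumr_ge0.
have Lfd0 : 0 <= Lf * delta by rewrite mulr_ge0// ltW.
have Cs0 := normr_ge0 Cs.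
(* A sum of nonnegative constants, all chosen before [h], [k] and [n], dominates each of them. *)
pose M := Lu + Lv + LG + BG + BA + LZ + BZ + Lf + Lf * delta + Sb + Sa + `|Cs|.
have M0 : 0 <= M by rewrite /M !addr_ge0.
(* Every bound below holds for all [h] in [H], so any positive threshold can serve as [h0]. *)
exists (lawson_constant T M), 1; split => // h k n Hh _ /andP[k0 kmaxk] nT.
have [nearL _ nearK] := near h Hh.
pose p t := grid_values (node h) (u t).
pose r t := Rh h (u t).
pose F t := grid_values (node h) (G t).
have Aunit := sd_unit sd Hh.
have bd0 t : inT t -> bd (u t) = 0 by move=> tT; rewrite (cp_bc cp tT) g0.
have ArE t : inT t -> Ah h *m r t = grid_values (node h) (A (u t)).
  move=> tT; have := sd_Rh sd Hh (cp_u_dom cp tT).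
  by rewrite bd0// linear0 addr0.
(* [Rh h] is a plain function, characterized only by the equation for [Ah h *m Rh h x]. On
   differences of solution values, where the boundary terms vanish, additivity follows from
   linearity of [A] and invertibility of [Ah h]. *)
have RhB z t t' : inT t -> inT t' -> incl z = u t' - u t ->
    Rh h (incl z) = r t' - r t.
  move=> tT t'T zE.
  have Du := cp_u_dom cp tT; have Du' := cp_u_dom cp t'T.
  have zE' : incl z = (-1) *: u t + u t' by rewrite zE scaleN1r addrC.
  have [Dz Az] := (cp_A_linear cp).2 (-1) _ _ Du Du'.
  have [_ bz] := (cp_bd_linear cp).2 (-1) _ _ Du Du'.
  have := sd_Rh sd Hh Dz; rewrite bz Az !bd0// scaler0 addr0 linear0 addr0 -zE'.
  rewrite grid_valuesD grid_valuesZ scaleN1r addrC -!ArE// -mulmxBr => e.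
  by rewrite -[LHS](mulKmx Aunit) e mulKmx.
(* Since [fh] commutes with sampling, [F t] is [fh h t] at the centre of the tube, so one
   application of the ball estimate compares it with any point of the tube. *)
have fhL t x : inT t -> nrm (x - p t) <= delta ->
    nrm (fh h t x - F t) <= Lf * nrm (x - p t).
  move=> tT xd; have -> : F t = fh h t (p t) by rewrite /F /G (sd_fh sd Hh).
  apply: le_trans (ball_lipschitz (sd_fh_C1 sd Hh) tT _ _ xd) _.
  - by move=> y w yd; exact: (nearL t y w tT yd).
  - by rewrite subrr nrm0 ltW.
  - by rewrite ler_wpM2r ?nrm_ge0// lerD2r ler_norm.
apply: (lawson_global_error (r := r) (F := F) (p := p) (delta := delta)
  (v := fun t => grid_values (node h) (v1 t))) => //.
- exact: (sd_contr sd Hh).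
- exact: (sd_eta_ge0 sd Hh).
- by move=> t tT; rewrite ArE// v1E// grid_valuesD.
- move=> t tT; rewrite ArE//; apply: le_trans (grid_values_le _ _) _.
  by apply: le_trans (AB _ tT) _; rewrite /M; lra.
- move=> t t' tT t'T; rewrite mulmxBr !ArE// -grid_valuesB.
  apply: le_trans (grid_values_le _ _) _; apply: le_trans (AL _ _ tT t'T) _.
  by rewrite ler_wpM2r// /M; lra.
- move=> t tT; apply: le_trans (grid_values_le _ _) _.
  by apply: le_trans (GB _ tT) _; rewrite /M; lra.
- move=> t t' tT t'T; rewrite -grid_valuesB.
  apply: le_trans (grid_values_le _ _) _; apply: le_trans (GL _ _ tT t'T) _.
  by rewrite ler_wpM2r// /M; lra.
- move=> t t' tT t'T; rewrite -grid_valuesB.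
  apply: le_trans (grid_values_le _ _) _; apply: le_trans (uL _ _ tT t'T) _.
  by rewrite ler_wpM2r// /M; lra.
- move=> t t0 tk; rewrite -grid_valuesZ -!grid_valuesB.
  apply: le_trans (grid_values_le _ _) _.
  apply: le_trans (taylor1_le du1 vL Lv0 t0 (ltW k0) tk) _.
  by rewrite ler_wpM2r ?sqr_ge0// /M; lra.
- move=> t tT; rewrite /p /r -uZE//; apply: le_trans (sd_eta sd Hh _) _.
  rewrite ler_wpM2l ?(sd_eta_ge0 sd Hh)//.
  by apply: le_trans (ZB _ tT) _; rewrite /M; lra.
- move=> t t' tT t'T.
  have zE : incl (uZ t' - uZ t) = u t' - u t by rewrite linearB !uZE.
  have -> : p t' - r t' - (p t - r t) =
      grid_values (node h) (incl (uZ t' - uZ t)) - Rh h (incl (uZ t' - uZ t)).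
    rewrite (RhB _ _ _ tT t'T zE) zE grid_valuesB -/(p t) -/(p t').
    by rewrite !opprB addrACA [RHS]addrACA; congr (_ + _); rewrite addrC.
  apply: le_trans (sd_eta sd Hh _) _; rewrite ler_wpM2l ?(sd_eta_ge0 sd Hh)//.
  apply: le_trans (ZL _ _ tT t'T) _.
  by rewrite ler_wpM2r// /M; lra.
- by rewrite -/Sb /M; lra.
- move=> i; apply: (@le_trans _ _ Sa); last by rewrite /M; lra.
  by rewrite /Sa [leRHS](bigD1 i)//= lerDl; apply: sumr_ge0 => l _; exact: sumr_ge0.
- by move=> t tT; rewrite g0// linear0.
- move=> t x tT xd; rewrite -[fh h t x](subrK (F t)).
  apply: le_trans (nrmD _ _) _.
  apply: (@le_trans _ _ (Lf * delta + BG)); last by rewrite /M; lra.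
  apply: lerD; last by apply: le_trans (grid_values_le _ _) _; exact: GB.
  by apply: le_trans (fhL _ _ tT xd) _; rewrite ler_wpM2l.
- move=> t x tT xd; apply: le_trans (fhL _ _ tT xd) _.
  by rewrite ler_wpM2r ?nrm_ge0// /M; lra.
- move=> j i jn; have jT : j.+1%:R * k <= T.
    by apply: le_trans nT; rewrite ler_wpM2r ?(ltW k0)// ler_nat.
  have kk : 0 < k <= kmax by rewrite k0.
  exact: (nearK k j i kk jT).
- move=> l ln x; have lT : l%:R * k <= T.
    by apply: le_trans nT; rewrite ler_wpM2r ?(ltW k0)// ler_nat.
  have kk : 0 < k <= kmax by rewrite k0.
  apply: le_trans (HCs h k l Hh kk lT x) _; rewrite ler_wpM2r ?nrm_ge0//.
  by apply: le_trans (ler_norm _) _; rewrite /M; lra.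
Qed.
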